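(* Let $\mathcal{A}$ be a C*-algebra and $a\in\mathcal{A}^+$. The map $f\mapsto\|f\|_a:=\|a^{1/2}fa^{1/2}\|$ is a norm on $\mathcal{A}^*$ if and only if $\varphi(a)>0$ for every nonzero positive continuous linear functional $\varphi$ on $\mathcal{A}$.
   Context: For $f\in\mathcal{A}^*$, $a^{1/2}fa^{1/2}$ is the functional $x\mapsto f(a^{1/2}xa^{1/2})$, and $\|\cdot\|$ is the norm of $\mathcal{A}^*$. *)

(* Defs.v *)
From HB Require Import structures.
From mathcomp Require Import all_boot all_order all_algebra.
From mathcomp Require Import complex.
From mathcomp Require Import boolp classical_sets reals.
Set Implicit Arguments. Unset Strict Implicit. Unset Printing Implicit Defensive.
Import Order.TTheory GRing.Theory Num.Theory.
Local Open Scope ring_scope.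
Local Open Scope classical_set_scope.
Local Open Scope complex_scope.

(* A (not necessarily unital) complex C*-algebra: a complex Banach algebra
   with an isometric-type involution satisfying the C*-identity.
   Scalars are R[i] for a real field R : realType; the norm is R-valued. *)
Record cstar_algebra (R : realType) := CStarAlgebra {
  cs_sort :> lmodType R[i];
  cs_mul : cs_sort -> cs_sort -> cs_sort;
  cs_star : cs_sort -> cs_sort;
  cs_norm : cs_sort -> R;
  cs_mulA : forall x y z, cs_mul x (cs_mul y z) = cs_mul (cs_mul x y) z;
  cs_mulDl : forall (c : R[i]) x y z,
      cs_mul (c *: x + y) z = c *: cs_mul x z + cs_mul y z;
  cs_mulDr : forall (c : R[i]) x y z,
      cs_mul z (c *: x + y) = c *: cs_mul z x + cs_mul z y;
  cs_norm_eq0 : forall x, cs_norm x = 0 -> x = 0;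
  cs_normD : forall x y, cs_norm (x + y) <= cs_norm x + cs_norm y;
  cs_normZ : forall (c : R[i]) x, cs_norm (c *: x) = ComplexField.Normc.normc c * cs_norm x;
  cs_normM : forall x y, cs_norm (cs_mul x y) <= cs_norm x * cs_norm y;
  cs_complete : forall u : nat -> cs_sort,
      (forall e : R, 0 < e -> exists N, forall m n, (N <= m)%N -> (N <= n)%N ->
          cs_norm (u m - u n) < e) ->
      exists l, forall e : R, 0 < e -> exists N, forall n, (N <= n)%N ->
          cs_norm (u n - l) < e;
  cs_starK : forall x, cs_star (cs_star x) = x;
  cs_starD : forall x y, cs_star (x + y) = cs_star x + cs_star y;
  cs_starZ : forall (c : R[i]) x, cs_star (c *: x) = c^* *: cs_star x;
  cs_starM : forall x y, cs_star (cs_mul x y) = cs_mul (cs_star y) (cs_star x);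
  cs_cstar : forall x, cs_norm (cs_mul (cs_star x) x) = cs_norm x ^+ 2
}.

Section Defs.
Variables (R : realType) (A : cstar_algebra R).

Definition cs_positive (a : A) : Prop := exists b : A, a = cs_mul (cs_star b) b.

Definition cs_linear_functional (f : A -> R[i]) : Prop :=
  forall (c : R[i]) (x y : A), f (c *: x + y) = c * f x + f y.

Definition cs_bounded (f : A -> R[i]) : Prop :=
  exists M : R, forall x : A, ComplexField.Normc.normc (f x) <= M * cs_norm x.

Definition cs_dual (f : A -> R[i]) : Prop :=
  cs_linear_functional f /\ cs_bounded f.

Definition cs_dual_norm (f : A -> R[i]) : R :=
  sup [set ComplexField.Normc.normc (f x) | x in [set x : A | cs_norm x <= 1]].

Definition cs_sandwich (r : A) (f : A -> R[i]) : A -> R[i] :=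
  fun x => f (cs_mul (cs_mul r x) r).

Definition cs_positive_functional (phi : A -> R[i]) : Prop :=
  cs_dual phi /\ forall x : A, 0 <= phi (cs_mul (cs_star x) x).

Definition is_norm_on_dual (N : (A -> R[i]) -> R) : Prop :=
  [/\ forall f, cs_dual f -> 0 <= N f,
      forall f, cs_dual f -> N f = 0 -> forall x, f x = 0,
      forall f g, cs_dual f -> cs_dual g -> N (fun x => f x + g x) <= N f + N g
    & forall (c : R[i]) f, cs_dual f ->
        N (fun x => c * f x) = ComplexField.Normc.normc c * N f].

End Defs.

(* Main.v *)
Require Import Defs.
From HB Require Import structures.
From mathcomp Require Import all_boot all_order all_algebra.
From mathcomp Require Import ring lra.
From mathcomp Require Import complex.
From mathcomp Require Import boolp classical_sets reals.
Import Order.TTheory GRing.Theory Num.Theory.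
Local Open Scope ring_scope.

(** The map is always a seminorm, so the question is whether [f (r x r) = 0] for
    all [x] forces [f = 0].  If [phi] is positive and [phi a = 0], Cauchy-Schwarz
    gives [phi (r x r) = 0] for all [x]; this is one implication.  For the other,
    apply Hahn-Banach to the gauge
      [p x = inf {l >= 0 : Re x <= l + t a for some t >= 0}],
    the order being that of the unitization.  A linear functional below [p] is
    positive and nonpositive at [a], so by hypothesis it vanishes; hence [p = 0],
    i.e. for all [d] and [e > 0] there is [t] with [d^* d <= e + t a].
    With [v = (1 - a / c)^n] one gets [|d v|^2 <= |v (e + t a) v| <= e + t c / n],
    and [1 - v] factors through [r] on both sides, so every [x] is approximated by
    elements of [r A r].

    The order theory needs only a C*-seminorm, neither definite nor complete: a
    selfadjoint element [h] is positive when [|c - h| <= c] for some real [c], a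
    condition visibly stable under sums, and square roots are only approximated,
    by polynomials.  So the unitization may carry the operator seminorm, even
    when it degenerates because the algebra already has a unit. *)

Set Implicit Arguments. Unset Strict Implicit. Unset Printing Implicit Defensive.

(** * Commutative algebras with a real C*-seminorm *)

Lemma ler_addeps (R : realType) (x y K : R) : 0 <= K ->
  (forall e, 0 < e -> e <= 1 -> x <= y + K * e) -> x <= y.
Proof.
move=> K0 h; rewrite leNgt; apply/negP => yx.
pose e := Num.min 1 ((x - y) / (K + 1) / 2).
have e0 : 0 < e by rewrite lt_min ltr01 /= divr_gt0 // divr_gt0 ?subr_gt0 //; lra.
have e1 : e <= 1 by rewrite ge_min lexx.
have e2 : e <= (x - y) / (K + 1) / 2 by rewrite ge_min lexx orbT.
have := h e e0 e1.
have : e * 2 * (K + 1) <= x - y.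
  by move: e2; rewrite ler_pdivlMr // ler_pdivlMr //; lra.
nra.
Qed.

(** [rcs_sqr] is what the C*-identity leaves on real elements: [s] is the real part of a normal
    element with imaginary part [t], whose squared modulus is [s^2 + t^2]. *)
Record real_cstar_seminorm (R : realType) (C : comNzRingType)
    (i : {rmorphism R -> C}) (nu : C -> R) : Prop := RealCstarSeminorm {
  rcs_ge0 : forall x, 0 <= nu x;
  rcs_D : forall x y, nu (x + y) <= nu x + nu y;
  rcs_M : forall x y, nu (x * y) <= nu x * nu y;
  rcs_Z : forall c x, nu (i c * x) = `|c| * nu x;
  rcs_1 : nu 1 <= 1;
  rcs_sqr : forall s t, nu s ^+ 2 <= nu (s ^+ 2 + t ^+ 2)
}.

Section CommutativeCone.
Variables (R : realType) (C : comNzRingType) (i : {rmorphism R -> C}).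
Variable nu : C -> R.
Hypothesis nuH : real_cstar_seminorm i nu.

Let nu_ge0 := rcs_ge0 nuH.
Let nuD := rcs_D nuH.
Let nuM := rcs_M nuH.
Let nuZ := rcs_Z nuH.
Let nu1 := rcs_1 nuH.
Let nuS := rcs_sqr nuH.

Definition cpos (x : C) := exists c : R, nu (i c - x) <= c.

Lemma cnuN x : nu (- x) = nu x.
Proof. by have := nuZ (-1) x; rewrite rmorphN rmorph1 mulN1r normrN1 mul1r. Qed.

Lemma cnu_const c : 0 <= c -> nu (i c) <= c.
Proof. by move=> c0; have := nuZ c 1; rewrite mulr1 ger0_norm // => ->; rewrite ler_piMr. Qed.

Lemma cnuC x y : nu (x - y) = nu (y - x).
Proof. by rewrite -cnuN opprB. Qed.

Lemma cnuX x n : nu (x ^+ n.+1) <= nu x ^+ n.+1.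
Proof.
elim: n => [|n IH]; first by rewrite !expr1.
by rewrite exprS [leRHS]exprS (le_trans (nuM _ _)) // ler_wpM2l.
Qed.

Lemma cposD x y : cpos x -> cpos y -> cpos (x + y).
Proof.
move=> [c hc] [d hd]; exists (c + d).
have -> : i (c + d) - (x + y) = (i c - x) + (i d - y) by ring.
by apply: (le_trans (nuD _ _)); lra.
Qed.

Lemma cposZ c x : 0 <= c -> cpos x -> cpos (i c * x).
Proof.
move=> c0 [d hd]; exists (c * d).
have -> : i (c * d) - i c * x = i c * (i d - x) by ring.
by rewrite nuZ ger0_norm // ler_wpM2l.
Qed.

Lemma cpos_const c : 0 <= c -> cpos (i c).
Proof.
move=> c0; exists c; rewrite subrr; have := nuZ 0 0.
by rewrite mulr0 normr0 mul0r => ->.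
Qed.

Lemma cpos1 : cpos 1.
Proof. by rewrite -(rmorph1 i); apply: cpos_const. Qed.

(* The iteration y <- (x + y^2) / 2 converges to 1 - sqrt (1 - x). *)
Lemma sqrt_approx_contraction x (q e : R) : 0 <= q < 1 -> nu x <= q -> 0 < e ->
  exists y, nu ((1 - y) ^+ 2 - (1 - x)) <= e.
Proof.
move=> /andP[q0 q1] xq e0.
have h2 : i 2^-1 * 2 = 1.
  by rewrite -(rmorph_nat i) -rmorphM mulVf ?rmorph1 // pnatr_eq0.
pose y := fix y n := if n is n'.+1 then i 2^-1 * (x + y n' ^+ 2) else 0.
have yq n : nu (y n) <= q.
  elim: n => [|n IH] /=.
    by have := nuZ 0 0; rewrite mulr0 normr0 mul0r => ->.
  rewrite nuZ ger0_norm ?invr_ge0 //.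
  have := nuD x (y n ^+ 2); have := cnuX (y n) 1; have := nu_ge0 (y n).
  by move: (nu (y n ^+ 2)) (nu _) (nu (y n)) IH xq => *; nra.
(* Successive differences are multiplied by [(y n.+1 + y n) / 2], of norm at most [q]. *)
have dq n : nu (y n.+1 - y n) <= q ^+ n.
  elim: n => [|n IH].
    by rewrite [y 0%N]/= subr0 expr0 (le_trans (yq 1%N)) // ltW.
  have -> : y n.+2 - y n.+1 = i 2^-1 * ((y n.+1 + y n) * (y n.+1 - y n)).
    transitivity (i 2^-1 * (x + y n.+1 ^+ 2) - i 2^-1 * (x + y n ^+ 2)) => //.
    by ring.
  rewrite nuZ ger0_norm ?invr_ge0 //.
  have h := nuM (y n.+1 + y n) (y n.+1 - y n).
  have h1 := nuD (y n.+1) (y n); have h3 := yq n; have h4 := yq n.+1.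
  have h5 := nu_ge0 (y n.+1 - y n).
  have h6 : nu (y n.+1 + y n) <= 2 * q by lra.
  have h7 := ler_pM (nu_ge0 _) h5 h6 IH.
  by rewrite exprS; lra.
have [n hn] : exists n, q ^+ n <= e / 2.
  have [->|qn0] := eqVneq q 0; first by exists 1%N; rewrite expr1; lra.
  have qp : 0 < q by rewrite lt_def qn0.
  pose t := q^-1 - 1.
  have t0 : 0 < t by rewrite subr_gt0 invf_gt1.
  have bern n : 1 + n%:R * t <= q ^- n.
    elim: n => [|n IH]; first by rewrite mul0r addr0 expr0 invr1.
    rewrite -exprVn exprS exprVn.
    have -> : q^-1 = 1 + t by rewrite /t; ring.
    rewrite -natr1; have : 0 <= n%:R :> R by [].
    by move: (n%:R : R) IH => m IH m0; nra.
  have [n hn] : exists n : nat, 2 / e / t <= n%:R.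
    exists (Num.truncn (2 / e / t)).+1; apply: ltW; apply: truncnS_gt.
  exists n; rewrite -[leLHS]invrK -[leRHS]invrK lef_pV2 ?posrE ?invr_gt0 ?exprn_gt0 ?divr_gt0 //.
  rewrite invf_div; apply: le_trans (bern n).
  by move: hn; rewrite ler_pdivrMr //; lra.
exists (y n).
(* The residual of the square root equation is twice one step of the iteration. *)
have -> : (1 - y n) ^+ 2 - (1 - x) = i 2 * (y n.+1 - y n).
  rewrite [y n.+1]/= mulrBr mulrA -rmorphM mulfV ?pnatr_eq0 // rmorph1.
  by rewrite rmorph_nat; ring.
rewrite nuZ ger0_norm //; have := dq n; lra.
Qed.

(** Dividing [c - h] by [c] would only give norm at most 1. Dividing by the larger [D = c + s] gives
    a strict contraction, at the price of approximating [h + s] in place of [h]; each of the two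
    errors is at most [s = e / 2]. *)
Lemma cpos_sqrt_approx h (e : R) : cpos h -> 0 < e -> exists t, nu (t ^+ 2 - h) <= e.
Proof.
move=> [c hc] e0.
have c0 : 0 <= c by apply: le_trans hc.
pose s := e / 2; pose D := c + s.
have s0 : 0 < s by rewrite divr_gt0.
have D0 : 0 < D by rewrite /D; lra.
pose x := i D^-1 * (i c - h).
have DV : i D * i D^-1 = 1 by rewrite -rmorphM mulfV ?rmorph1 // gt_eqF.
have [|||y hy] := @sqrt_approx_contraction x (c / D) (s / D).
- by rewrite divr_ge0 ?(ltW D0) //= ltr_pdivrMr // mul1r /D; lra.
- by rewrite /x nuZ ger0_norm ?invr_ge0 ?(ltW D0) // mulrC ler_wpM2r // invr_ge0 ltW.
- by rewrite divr_gt0.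
exists (i (Num.sqrt D) * (1 - y)).
have -> : (i (Num.sqrt D) * (1 - y)) ^+ 2 - h = i D * ((1 - y) ^+ 2 - (1 - x)) + i s.
  rewrite exprMn -rmorphXn sqr_sqrtr ?(ltW D0) // /x.
  have -> : i D * ((1 - y) ^+ 2 - (1 - i D^-1 * (i c - h))) =
    i D * (1 - y) ^+ 2 - i D + (i D * i D^-1) * (i c - h) by ring.
  by rewrite DV /D; ring.
apply: (le_trans (nuD _ _)).
rewrite nuZ gtr0_norm //; have := cnu_const (ltW s0).
move: hy; rewrite ler_pdivlMr //.
have -> : e = s + s by rewrite /s; lra.
by lra.
Qed.

(** If [s^2] and [t^2] approximate [k] and [c - k], then [s^2 + t^2] is close to [c], and [rcs_sqr]
    bounds the norm of [s^2]. The approximations enter three times, hence the constant 3. *)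
Lemma cpos_norm_le k (c : R) : 0 <= c -> cpos k -> cpos (i c - k) -> nu k <= c.
Proof.
move=> c0 kp ckp; apply: (@ler_addeps _ _ _ 3) => // e e0 _.
have [s hs] := cpos_sqrt_approx kp e0.
have [t ht] := cpos_sqrt_approx ckp e0.
have h1 : nu k <= nu (s ^+ 2) + nu (k - s ^+ 2).
  by have := nuD (s ^+ 2) (k - s ^+ 2); rewrite addrC subrK.
rewrite cnuC in hs.
have h2 := cnuX s 1; have h3 := nuS s t.
have h4 : nu (s ^+ 2 + t ^+ 2) <= nu (i c) + (nu (k - s^+2) + nu (t ^+ 2 - (i c - k))).
  rewrite -[nu (k - _)]cnuN.
  have -> : s ^+ 2 + t ^+ 2 = i c + (- (k - s ^+ 2) + (t ^+ 2 - (i c - k))) by ring.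
  by apply: (le_trans (nuD _ _)); rewrite lerD2l nuD.
have := cnu_const c0; lra.
Qed.

(** Any bound of the norm can serve as the witness of positivity. Such a uniform choice is what
    limit arguments need. *)
Lemma cpos_bound x c : cpos x -> nu x <= c -> nu (i c - x) <= c.
Proof.
move=> xp xc; apply: cpos_norm_le; first exact: le_trans xc.
- by exists c; have -> : i c - (i c - x) = x by ring.
- by have -> : i c - (i c - x) = x by ring.
Qed.

(** By [cpos_bound] the witness for [x + e] can be [nu x + e]; the two [e] cancel in the difference,
    which is [nu x - x]. *)
Lemma cpos_closed x : (forall e, 0 < e -> cpos (x + i e)) -> cpos x.
Proof.
move=> h; exists (nu x).
apply: (@ler_addeps _ _ _ 2) => // e e0 _.
have := @cpos_bound (x + i e) (nu x + e) (h e e0).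
have -> : i (nu x + e) - (x + i e) = i (nu x) - x by ring.
have := nuD x (i e); have := cnu_const (ltW e0) => h1 h2 /(_ _)h3.
have : nu (i (nu x) - x) <= nu x + e by apply: h3; lra.
lra.
Qed.

(** Since [c] exceeds [nu h ^+ 2], the element [c - h^2] has an approximate square root [t]. Then
    [t^2 + h^2] is close to [c], so [rcs_sqr] bounds [t^2], and thereby [c - h^2], by about [c]. *)
Lemma cpos_sqr h : cpos (h ^+ 2).
Proof.
pose c := nu h ^+ 2 + 1.
have c0 : 0 < c by rewrite /c; have := sqr_ge0 (nu h); lra.
have cV : i c * i c^-1 = 1 by rewrite -rmorphM mulfV ?rmorph1 // gt_eqF.
exists c; apply: (@ler_addeps _ _ _ 2) => // e e0 _.
have [|||y hy] := @sqrt_approx_contraction (i c^-1 * h ^+ 2) (nu h ^+ 2 / c) (e / c).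
- by rewrite divr_ge0 ?(ltW c0) ?sqr_ge0 //= ltr_pdivrMr // mul1r /c; lra.
- rewrite nuZ ger0_norm ?invr_ge0 ?(ltW c0) // mulrC ler_wpM2r ?invr_ge0 ?(ltW c0) //.
  exact: cnuX.
- by rewrite divr_gt0.
pose t := i (Num.sqrt c) * (1 - y).
have ht : nu (t ^+ 2 - (i c - h ^+ 2)) <= e.
  have -> : t ^+ 2 - (i c - h ^+ 2) = i c * ((1 - y) ^+ 2 - (1 - i c^-1 * h ^+ 2)).
    rewrite /t exprMn -rmorphXn sqr_sqrtr ?(ltW c0) //.
    have -> : i c * ((1 - y) ^+ 2 - (1 - i c^-1 * h ^+ 2)) =
      i c * (1 - y) ^+ 2 - i c + (i c * i c^-1) * h ^+ 2 by ring.
    by rewrite cV; ring.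
  by rewrite nuZ gtr0_norm // -ler_pdivlMl // [leRHS]mulrC.
have h1 := nuS t h.
have h2 : nu (t ^+ 2 + h ^+ 2) <= nu (i c) + e.
  have -> : t ^+ 2 + h ^+ 2 = i c + (t ^+ 2 - (i c - h ^+ 2)) by ring.
  by apply: (le_trans (nuD _ _)); lra.
have h3 := cnu_const (ltW c0).
have h4 := cnuX t 1.
have : nu (i c - h ^+ 2) <= nu (t ^+ 2) + e.
  have -> : i c - h ^+ 2 = t ^+ 2 + (i c - h ^+ 2 - t ^+ 2) by ring.
  by apply: (le_trans (nuD _ _)); rewrite cnuC in ht; lra.
lra.
Qed.

(** By commutativity, approximate square roots [s] and [t] give the square [(s t)^2] close to [x y];
    squares are positive and the cone is closed. *)
Lemma cposM x y : cpos x -> cpos y -> cpos (x * y).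
Proof.
move=> xp yp; apply: cpos_closed => e e0.
pose K := nu x + nu y + 1.
have K0 : 0 < K by rewrite /K; have := nu_ge0 x; have := nu_ge0 y; lra.
(* The total error is at most [d (nu y + d) + nu x d], which is below [d K] as soon as [d <= 1]. *)
pose d := Num.min 1 (e / K).
have d0 : 0 < d by rewrite lt_min ltr01 divr_gt0.
have d1 : d <= 1 by rewrite ge_min lexx.
have dK : d * K <= e by rewrite -ler_pdivlMr // ge_min lexx orbT.
have [s hs] := cpos_sqrt_approx xp d0.
have [t ht] := cpos_sqrt_approx yp d0.
have -> : x * y + i e = (s * t) ^+ 2 + (i e - ((s * t) ^+ 2 - x * y)) by ring.
apply: cposD; first exact: cpos_sqr.
exists e; rewrite opprB addrCA subrr addr0.
have -> : (s * t) ^+ 2 - x * y = (s ^+ 2 - x) * (t ^+ 2) + x * (t ^+ 2 - y) by ring.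
apply: (le_trans (nuD _ _)).
have ht2 : nu (t ^+ 2) <= nu y + d.
  have -> : t ^+ 2 = y + (t ^+ 2 - y) by ring.
  by apply: (le_trans (nuD _ _)); lra.
have h1 := le_trans (nuM _ _) (ler_pM (nu_ge0 _) (nu_ge0 _) hs ht2).
have h2 := le_trans (nuM _ _) (ler_wpM2l (nu_ge0 x) ht).
apply: (le_trans (lerD h1 h2)); apply: le_trans dK; rewrite /K.
have := nu_ge0 x; nra.
Qed.

Lemma cposX x n : cpos x -> cpos (x ^+ n).
Proof.
move=> xp; elim: n => [|n IH]; first by rewrite expr0; exact: cpos1.
by rewrite exprS; apply: cposM.
Qed.

(** The polynomial has a double root at 1: it is [(1 - v)^2] times the sum of [(k + 1) v^k] over
    [k < N]. *)
Lemma cpos_tangent v N : cpos v -> cpos (1 - N.+1%:R * v ^+ N + N%:R * v ^+ N.+1).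
Proof.
move=> vp; elim: N => [|N IH].
  by rewrite mul0r addr0 expr0 mulr1 subrr -(rmorph0 i); apply: cpos_const.
have -> : 1 - N.+2%:R * v ^+ N.+1 + N.+1%:R * v ^+ N.+2 =
   (1 - N.+1%:R * v ^+ N + N%:R * v ^+ N.+1) + i N.+1%:R * (v ^+ N * (1 - v) ^+ 2).
  by rewrite rmorph_nat -[N.+2%:R]natr1 -[N.+1%:R]natr1 !exprS; ring.
apply: cposD => //; apply: cposZ => //; apply: cposM; last exact: cpos_sqr.
exact: cposX.
Qed.

Lemma cpos_chebyshev v N : cpos v -> cpos ((v - 1) * (v ^+ N - 1)).
Proof.
move=> vp; elim: N => [|N IH].
  by rewrite expr0 subrr mulr0 -(rmorph0 i); apply: cpos_const.
have -> : (v - 1) * (v ^+ N.+1 - 1) = (v - 1) * (v ^+ N - 1) + v ^+ N * (v - 1) ^+ 2.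
  by rewrite exprS; ring.
by apply: cposD => //; apply: cposM; [exact: cposX | exact: cpos_sqr].
Qed.

(** After multiplication by [N.+1] the difference is the polynomial of [cpos_tangent] at [N.+1] plus
    [v ^+ N.+1]. *)
Lemma cpos_peak v N : cpos v -> cpos (i N.+1%:R^-1 - v ^+ N.+1 * (1 - v)).
Proof.
move=> vp.
have -> : i N.+1%:R^-1 - v ^+ N.+1 * (1 - v) = i N.+1%:R^-1 *
  ((1 - N.+2%:R * v ^+ N.+1 + N.+1%:R * v ^+ N.+2) + v ^+ N.+1).
  have -> : (1 - N.+2%:R * v ^+ N.+1 + N.+1%:R * v ^+ N.+2) + v ^+ N.+1 =
     1 - i N.+1%:R * (v ^+ N.+1 * (1 - v)).
    by rewrite rmorph_nat -[N.+2%:R]natr1 [v ^+ N.+2]exprS; ring.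
  move: (v ^+ N.+1 * (1 - v)) => X; rewrite mulrBr mulr1 mulrA -(rmorphM i).
  by rewrite mulVf ?pnatr_eq0 // rmorph1 mul1r.
apply: cposZ; first by rewrite invr_ge0.
by apply: cposD; [exact: cpos_tangent | exact: cposX].
Qed.

Lemma nu_peak v N : cpos v -> cpos (1 - v) -> nu (v ^+ N.+1 * (1 - v)) <= N.+1%:R^-1.
Proof.
move=> vp wp; apply: cpos_norm_le; first by rewrite invr_ge0.
- by apply: cposM => //; exact: cposX.
- exact: cpos_peak.
Qed.

End CommutativeCone.

(** * Algebras with a C*-seminorm *)

Import ComplexField.Normc.

Lemma normc_real (R : realType) (c : R) : normc (c%:C)%C = `|c|.
Proof. by rewrite /normc /= expr0n /= addr0 sqrtr_sqr. Qed.

Lemma conjc_i (R : realType) : (('i : R[i])^*)%C = - 'i%C.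
Proof. by apply/eqP; rewrite eq_complex /= oppr0 !eqxx. Qed.

Lemma mul_ii (R : realType) : 'i%C * 'i%C = -1 :> R[i].
Proof.
by apply/eqP; rewrite eq_complex /= !mul0r !mulr0 !mulr1 sub0r add0r oppr0 !eqxx.
Qed.

Lemma conjc_real_complex (R : realType) (c : R) : ((c%:C)^*)%C = (c%:C)%C.
Proof. by rewrite /= oppr0. Qed.

(** A linear factor disappears under [2 ^ k]-th roots. If [e < g], Bernoulli's inequality makes the
    powers of [g / e] grow only linearly, so it is squared, passing from [k] to [k.+1], to beat the
    factor. *)
Lemma le_of_pow2_le (R : realType) (g e : R) : 0 <= g -> 0 <= e ->
  (forall k, g ^+ (2 ^ k) <= (2 ^ k).+1%:R * e ^+ (2 ^ k)) -> g <= e.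
Proof.
move=> g0 e0 h; rewrite leNgt; apply/negP => eg.
have [e00|en0] := eqVneq e 0.
  have := h 0%N; rewrite expn0 !expr1 e00 mulr0 => h0.
  by move: eg; rewrite e00; lra.
have ep : 0 < e by rewrite lt_def en0.
pose t := g / e - 1.
have t0 : 0 < t by rewrite subr_gt0 ltr_pdivlMr // mul1r.
have bern m : 1 + m%:R * t <= (g / e) ^+ m.
  elim: m => [|m IH]; first by rewrite mul0r addr0 expr0.
  rewrite exprS; have -> : g / e = 1 + t by rewrite /t; ring.
  have ht : g / e = 1 + t by rewrite /t; ring.
  rewrite ht in IH.
  rewrite -natr1; have : 0 <= m%:R :> R by [].
  by move: (m%:R : R) IH => M IH M0; nra.
have up k : (g / e) ^+ (2 ^ k) <= (2 ^ k).+1%:R.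
  by rewrite expr_div_n ler_pdivrMr ?exprn_gt0.
have [k hk] : exists k : nat, 2 / t ^+ 2 <= k%:R.
  exists (Num.truncn (2 / t ^+ 2)).+1; apply: ltW; apply: truncnS_gt.
have hk2 : (k%:R : R) <= (2 ^ k)%:R by rewrite ler_nat ltnW // ltn_expl.
have := up k.+1; have := bern (2 ^ k)%N.
rewrite expnS mulnC exprM -natr1 natrM.
have : 2 <= (2 ^ k)%:R * t ^+ 2.
  by rewrite -ler_pdivrMr ?exprn_gt0 //; apply: le_trans hk2.
have : 1 <= (2 ^ k)%:R :> R by rewrite ler1n expn_gt0.
move: ((2 ^ k)%:R : R) ((g / e) ^+ (2 ^ k)) => m x m1 mt mx xm.
have : (1 + m * t) ^+ 2 <= x ^+ 2 by rewrite ler_sqr ?nnegrE; nra.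
nra.
Qed.

(** [csn_1] is an inequality because on the unitization of the zero algebra the operator seminorm
    vanishes. *)
Record is_cstar_seminorm (R : realType) (U : algType R[i])
    (star : U -> U) (N : U -> R) : Prop := IsCstarSeminorm {
  csn_starK : forall x, star (star x) = x;
  csn_starD : forall x y, star (x + y) = star x + star y;
  csn_starZ : forall c x, star (c *: x) = (c^*)%C *: star x;
  csn_starM : forall x y, star (x * y) = star y * star x;
  csn_ge0 : forall x, 0 <= N x;
  csn_D : forall x y, N (x + y) <= N x + N y;
  csn_M : forall x y, N (x * y) <= N x * N y;
  csn_Z : forall c x, N (c *: x) = normc c * N x;
  csn_1 : N 1 <= 1;
  csn_cstar : forall x, N (star x * x) = N x ^+ 2
}.

Section CstarSeminorm.
Variables (R : realType) (U : algType R[i]) (star : U -> U) (N : U -> R).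
Hypothesis H : is_cstar_seminorm star N.

Local Notation rs c := ((c%:C)%C%:A : U).

Let starK := csn_starK H.
Let starD := csn_starD H.
Let starZ := csn_starZ H.
Let starM := csn_starM H.
Let N_ge0 := csn_ge0 H.
Let ND := csn_D H.
Let NM := csn_M H.
Let NZ := csn_Z H.
Let NC := csn_cstar H.

Lemma csn_star0 : star 0 = 0.
Proof. by apply: (addrI (star 0)); rewrite -starD !addr0. Qed.

Lemma csn_starN x : star (- x) = - star x.
Proof. by apply/eqP; rewrite -addr_eq0 -starD addNr csn_star0. Qed.

Lemma csn_starB x y : star (x - y) = star x - star y.
Proof. by rewrite starD csn_starN. Qed.

Lemma csn_star1 : star 1 = 1.
Proof.
have := starM (star 1) 1; rewrite mulr1 starK => h.
by rewrite [RHS]h mulr1.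
Qed.

Lemma csn_star_real c : star (rs c) = rs c.
Proof. by rewrite starZ conjc_real_complex csn_star1. Qed.

Lemma csn_starX x n : star (x ^+ n) = star x ^+ n.
Proof.
elim: n => [|n IH]; first by rewrite !expr0 csn_star1.
by rewrite exprS exprSr starM IH.
Qed.

Lemma csn_N0 : N 0 = 0.
Proof. by rewrite -(scale0r (0 : U)) NZ normc0 mul0r. Qed.

Lemma csn_NN x : N (- x) = N x.
Proof.
have := NZ (((-1)%:C)%C) x; rewrite normc_real normrN1 mul1r rmorphN rmorph1.
by rewrite scaleN1r.
Qed.

Lemma csn_NBC x y : N (x - y) = N (y - x).
Proof. by rewrite -csn_NN opprB. Qed.

Lemma csn_Nstar x : N (star x) = N x.
Proof.
have le y : N y <= N (star y).
  have [->|yn0] := eqVneq (N y) 0; first exact: N_ge0.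
  have yp : 0 < N y by rewrite lt_def yn0 N_ge0.
  by rewrite -(ler_pM2r yp) -expr2 -NC NM.
by apply/le_anti; rewrite le -{2}[x]starK le.
Qed.

Lemma csn_Zreal c x : N ((c%:C)%C *: x) = `|c| * N x.
Proof. by rewrite NZ normc_real. Qed.

Lemma csn_Nreal c : 0 <= c -> N (rs c) <= c.
Proof.
by move=> c0; rewrite csn_Zreal ger0_norm // ler_piMr // (csn_1 H).
Qed.

(** * Real polynomials in a selfadjoint element *)

Definition ev (h : U) (p : {poly R}) : U :=
  horner_alg h (map_poly (real_complex R) p).

Lemma evD h p q : ev h (p + q) = ev h p + ev h q.
Proof. by rewrite /ev !rmorphD. Qed.
Lemma evN h p : ev h (- p) = - ev h p.
Proof. by rewrite /ev !rmorphN. Qed.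
Lemma evB h p q : ev h (p - q) = ev h p - ev h q.
Proof. by rewrite evD evN. Qed.
Lemma evM h p q : ev h (p * q) = ev h p * ev h q.
Proof. by rewrite /ev !rmorphM. Qed.
Lemma evX h : ev h 'X = h.
Proof. by rewrite /ev map_polyX horner_algX. Qed.
Lemma evC h c : ev h c%:P = rs c.
Proof. by rewrite /ev map_polyC horner_algC. Qed.
Lemma ev1 h : ev h 1 = 1.
Proof. by rewrite /ev !rmorph1. Qed.
Lemma ev_exp h p n : ev h (p ^+ n) = ev h p ^+ n.
Proof. by rewrite /ev !rmorphXn. Qed.

Lemma star_ev h p : star h = h -> star (ev h p) = ev h p.
Proof.
move=> hs; elim/poly_ind: p => [|p c IH]; first by rewrite /ev !rmorph0 csn_star0.
rewrite evD starD evC csn_star_real; congr (_ + _).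
by rewrite {1}evM starM IH evX hs mulrC evM evX.
Qed.

Definition nuev h (p : {poly R}) : R := N (ev h p).

(* With u = ev h s + i ev h t one has u^* u = ev h (s^2 + t^2), and ev h s is
   the real part of u. *)
Lemma nuev_sqr h s t : star h = h ->
  nuev h s ^+ 2 <= nuev h (s ^+ 2 + t ^+ 2).
Proof.
move=> hs; rewrite /nuev; pose u := ev h s + 'i%C *: ev h t.
have us : star u = ev h s - 'i%C *: ev h t.
  rewrite starD starZ !star_ev //.
  rewrite conjc_i.
  by rewrite scaleNr.
have -> : ev h (s ^+ 2 + t ^+ 2) = star u * u.
  rewrite us /u mulrBl !mulrDr -!scalerAl -!scalerAr scalerA.
  rewrite mul_ii.
  rewrite -!evM [t * s]mulrC scaleN1r opprD opprK addrA addrK.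
  by rewrite evD !expr2.
rewrite NC ler_sqr ?nnegrE //.
have : ev h s = ((2^-1)%:C)%C *: (u + star u).
  rewrite us /u addrACA subrr addr0 -mulr2n -scaler_nat scalerA.
  by rewrite -(rmorph_nat (real_complex R)) -rmorphM mulVf ?pnatr_eq0 // rmorph1 scale1r.
move=> ->; rewrite csn_Zreal ger0_norm ?invr_ge0 //.
have := ND u (star u); rewrite csn_Nstar; lra.
Qed.

Local Notation pC := (polyC : {rmorphism R -> {poly R}}).

(** This makes the results on commutative algebras available for the polynomials in one selfadjoint
    element. *)
Lemma nuevP h : star h = h -> real_cstar_seminorm pC (nuev h).
Proof.
move=> hs; split=> [p|p q|p q|c p||s t].
- exact: N_ge0.
- by rewrite /nuev evD ND.
- by rewrite /nuev evM NM.
- by rewrite /nuev evM evC mulr_algl csn_Zreal.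
- by rewrite /nuev ev1 (csn_1 H).
- exact: nuev_sqr.
Qed.

(** * The positive cone *)

Definition csn_pos (h : U) := star h = h /\ exists c : R, N (rs c - h) <= c.

Local Notation cposev h := (cpos pC (nuev h)).

Lemma csn_pos_ev h p : star h = h -> csn_pos (ev h p) <-> cposev h p.
Proof.
move=> hs; split.
  by move=> [_ [c hc]]; exists c; rewrite /nuev evB evC.
move=> [c hc]; split; first exact: star_ev.
by exists c; move: hc; rewrite /nuev evB evC.
Qed.

Lemma csn_posD x y : csn_pos x -> csn_pos y -> csn_pos (x + y).
Proof.
move=> [xs [c hc]] [ys [d hd]]; split; first by rewrite starD xs ys.
exists (c + d); rewrite rmorphD scalerDl opprD addrACA.
by apply: (le_trans (ND _ _)); lra.
Qed.

Lemma csn_posZ c x : 0 <= c -> csn_pos x -> csn_pos ((c%:C)%C *: x).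
Proof.
move=> c0 [xs [d hd]]; split; first by rewrite starZ conjc_real_complex xs.
exists (c * d); rewrite rmorphM -scalerA -scalerBr csn_Zreal ger0_norm //.
by rewrite ler_wpM2l.
Qed.

Lemma csn_pos_small x c : star x = x -> N x <= c -> csn_pos (rs c - x).
Proof.
move=> xs xc; split; first by rewrite csn_starB csn_star_real xs.
by exists c; rewrite opprB addrC subrK.
Qed.

Lemma csn_pos0 : csn_pos 0.
Proof.
by split; [rewrite csn_star0 | exists 0; rewrite subr0 csn_Zreal normr0 mul0r].
Qed.

Lemma csn_pos_sqr h : star h = h -> csn_pos (h * h).
Proof.
move=> hs; have -> : h * h = ev h ('X ^+ 2) by rewrite ev_exp evX expr2.
by apply/csn_pos_ev => //; apply: (cpos_sqr (nuevP hs)).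
Qed.

Lemma csn_pos_sqrt_approx k (e : R) : csn_pos k -> 0 < e ->
  exists z, star z = z /\ N (z * z - k) <= e.
Proof.
move=> kp e0; have ks := kp.1.
have kp' : cposev k 'X by apply/csn_pos_ev => //; rewrite evX.
have [t ht] := cpos_sqrt_approx (nuevP ks) kp' e0.
exists (ev k t); split; first exact: star_ev.
by move: ht; rewrite /nuev evB expr2 evM evX.
Qed.

Lemma csn_pos_norm_le k (c : R) : 0 <= c -> csn_pos k -> csn_pos (rs c - k) -> N k <= c.
Proof.
move=> c0 kp ckp; have ks := kp.1.
have kp' : cposev k 'X by apply/csn_pos_ev => //; rewrite evX.
have ckp' : cposev k (c%:P - 'X) by apply/csn_pos_ev => //; rewrite evB evX evC.
by have := cpos_norm_le (nuevP ks) c0 kp' ckp'; rewrite /nuev evX.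
Qed.

Lemma csn_pos_closed x : star x = x -> (forall e, 0 < e -> csn_pos (x + rs e)) -> csn_pos x.
Proof.
move=> xs h; rewrite -(evX x); apply/csn_pos_ev => //.
apply: (cpos_closed (nuevP xs)) => e e0.
by apply/csn_pos_ev => //; rewrite evD evX evC; apply: h.
Qed.

Lemma csn_pos_approx x : star x = x ->
  (forall e, 0 < e -> exists x', csn_pos x' /\ N (x - x') <= e) -> csn_pos x.
Proof.
move=> xs h; apply: csn_pos_closed => // e e0.
have [x' [x'p hx']] := h e e0.
have -> : x + rs e = x' + (rs e - (x' - x)) by rewrite opprB addrCA [x' + _]addrC subrK addrC.
apply: csn_posD => //; apply: csn_pos_small; first by rewrite csn_starB xs x'p.1.
by rewrite csn_NBC.
Qed.

Lemma csn_peak v n : csn_pos v -> csn_pos (1 - v) -> N (v ^+ n.+1 * (1 - v)) <= n.+1%:R^-1.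
Proof.
move=> vp wp; have vs := vp.1.
have vp' : cposev v 'X by apply/csn_pos_ev => //; rewrite evX.
have wp' : cposev v (1 - 'X) by apply/csn_pos_ev => //; rewrite evB evX ev1.
by have := nu_peak (nuevP vs) n vp' wp'; rewrite /nuev evM evB ev_exp evX ev1.
Qed.

(* The powers of [y y^* + D] have the form [D^n + y Q y^*] with [Q] a polynomial
   in [y^* y + D], whose norm is at most [D + d]; the norm of a selfadjoint
   element is read off from its [2 ^ k]-th powers. *)
Lemma csn_pos_swap y (d : R) : 0 <= d -> csn_pos (rs d - star y * y) -> csn_pos (rs d - y * star y).
Proof.
move=> d0 hp.
pose D := N y ^+ 2; pose E := D + d; pose k := star y * y + rs D.
have D0 : 0 <= D by exact: sqr_ge0.
have ks : star k = k by rewrite starD starM starK csn_star_real.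
have kE : N k <= E.
  apply: csn_pos_norm_le; first by rewrite addr_ge0.
    have -> : k = rs D - (- (star y * y)) by rewrite opprK addrC.
    apply: csn_pos_small; first by rewrite csn_starN starM starK.
    by rewrite csn_NN NC.
  suff -> : rs E - k = rs d - star y * y by [].
  by rewrite /k /E rmorphD scalerDl [rs D + _]addrC opprD addrACA subrr addr0.
pose G := y * star y + rs D.
have Gs : star G = G by rewrite starD starM starK csn_star_real.
(* The quantity [D * N Q] is controlled because it bounds the norm of [y Q y^*], as [D] is the
   square of [N y]. *)
have step n : exists Q, G ^+ n = rs (D ^+ n) + y * Q * star y /\ D * N Q <= n%:R * E ^+ n.
  elim: n => [|n [Q [GQ hQ]]].
    exists 0; rewrite !expr0 mulr0 mul0r addr0 csn_N0 mulr0 mul0r; split=> //.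
    by rewrite rmorph1 scale1r.
  exists (Q * k + rs (D ^+ n)); split.
    have -> : y * (Q * k + rs (D ^+ n)) * star y = y * Q * star y * (y * star y)
        + (D%:C)%C *: (y * Q * star y) + ((D ^+ n)%:C)%C *: (y * star y).
      rewrite /k !(mulrDr, mulrDl) !mulr_algr.
      by rewrite -!(scalerAr, scalerAl) !mulrA.
    rewrite exprSr GQ /G mulrDr 2!mulrDl !mulr_algl mulr_algr.
    rewrite scalerA -rmorphM -exprSr addrC -addrA; congr (_ + _).
    by rewrite addrCA addrC; congr (_ + _); exact: addrC.
  have h1 := ND (Q * k) (rs (D ^+ n)).
  have h2 := le_trans (NM Q k) (ler_wpM2l (N_ge0 Q) kE).
  have h3 : N (rs (D ^+ n)) <= D ^+ n by apply: csn_Nreal; rewrite exprn_ge0.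
  have h4 : D ^+ n.+1 <= E ^+ n.+1 by rewrite lerXn2r ?nnegrE ?addr_ge0 // lerDl.
  have E0 : 0 <= E by rewrite addr_ge0.
  have h5 : N (Q * k + rs (D ^+ n)) <= N Q * E + D ^+ n by lra.
  have h6 := ler_wpM2l D0 h5; have h7 := ler_wpM2r E0 hQ.
  have e1 : D * (N Q * E + D ^+ n) = D * N Q * E + D ^+ n.+1 by rewrite exprS; ring.
  have e2 : n.+1%:R * E ^+ n.+1 = n%:R * E ^+ n * E + E ^+ n.+1.
    by rewrite -natr1 exprSr; ring.
  by rewrite e1 in h6; rewrite e2; lra.
have GE n : N (G ^+ n) <= n.+1%:R * E ^+ n.
  have [Q [-> hQ]] := step n; apply: (le_trans (ND _ _)).
  have h3 : N (rs (D ^+ n)) <= D ^+ n by apply: csn_Nreal; rewrite exprn_ge0.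
  have h4 : D ^+ n <= E ^+ n by rewrite lerXn2r ?nnegrE ?addr_ge0 // lerDl.
  have h5 : N (y * Q * star y) <= D * N Q.
    apply: (le_trans (NM _ _)); rewrite csn_Nstar mulrC /D expr2 -mulrA.
    by rewrite ler_wpM2l // NM.
  rewrite -natr1 mulrDl mul1r; lra.
have G2 j : N (G ^+ (2 ^ j)) = N G ^+ (2 ^ j).
  elim: j => [|j IH]; first by rewrite !expn0 !expr1.
  by rewrite expnS mulnC !exprM -IH -NC csn_starX Gs expr2.
have GlE : N G <= E.
  by apply: le_of_pow2_le; rewrite ?addr_ge0 // => j; rewrite -G2 GE.
split; first by rewrite csn_starB csn_star_real starM starK.
exists E; suff -> : rs E - (rs d - y * star y) = G by [].
by rewrite /E /G rmorphD scalerDl opprB addrC [rs D + _]addrC addrA subrK.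
Qed.

(** Here [p] and [q] are, up to sign, twice the real and imaginary parts of [y], and the sum is half
    of [p^2 + q^2]. *)
Lemma csn_pos_star_mul_add y : csn_pos (star y * y + y * star y).
Proof.
pose p := y + star y; pose q := 'i%C *: (y - star y).
have ps : star p = p by rewrite starD starK addrC.
have qs : star q = q.
  rewrite starZ csn_starB starK.
  rewrite conjc_i.
  by rewrite scaleNr -scalerN opprB.
have -> : star y * y + y * star y = ((2^-1)%:C)%C *: (p * p + q * q).
  have -> : q * q = - ((y - star y) * (y - star y)).
    rewrite -scalerAl -scalerAr scalerA.
    rewrite mul_ii.
    by rewrite scaleN1r.
  have -> : p * p - (y - star y) * (y - star y) = (star y * y + y * star y) *+ 2.
    rewrite /p mulrBl mulrBr mulrBr mulrDl mulrDr mulrDr.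
    set a := y * y; set b := star y * y; set c := y * star y; set e := star y * star y.
    set s := b + c.
    have -> : a + c + (b + e) = s + (a + e).
      by rewrite [b + e]addrC addrACA [c + b]addrC addrC.
    have -> : a - c - (b - e) = (a + e) - s.
      by rewrite opprB addrACA [- c - b]addrC -opprD.
    by rewrite opprB addrACA subrr addr0 mulr2n.
  rewrite -scaler_nat scalerA -(rmorph_nat (real_complex R)) -rmorphM.
  by rewrite mulVf ?pnatr_eq0 // rmorph1 scale1r.
by apply: csn_posZ; rewrite ?invr_ge0 //; apply: csn_posD; apply: csn_pos_sqr.
Qed.

(* Put [c >= N h], [V = 1 - h / c] and [y = x V^n], so that
   [y^* y = c (1 - V) V^(2n) <= c / 2n].  Then also [y y^* <= c / 2n], and since
   [y^* y + y y^*] is positive, [- c / 2n <= c (1 - V) V^(2n) <= c (1 - V) = h]. *)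
Lemma csn_pos_star_mul x : csn_pos (star x * x).
Proof.
pose h := star x * x.
have hs : star h = h by rewrite starM starK.
have S := nuevP hs.
rewrite -/h -(evX h); apply/csn_pos_ev => //.
pose c := N h + 1.
have c0 : 0 < c by rewrite /c; have := N_ge0 h; lra.
pose V : {poly R} := 1 - (c^-1)%:P * 'X.
have XV : 'X = c%:P * (1 - V) :> {poly R}.
  by rewrite /V opprB addrC subrK mulrA -polyCM mulfV ?gt_eqF // mul1r.
have Vp : cposev h V.
  exists 1; rewrite /V opprB addrC subrK rcs_Z // ger0_norm ?invr_ge0 ?(ltW c0) //.
  by rewrite /nuev evX -ler_pdivlMl ?invr_gt0 // invrK mulr1 /c lerDl.
apply: (cpos_closed S) => e e0.
have [m hm] : exists m : nat, c / e <= m%:R.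
  by exists (Num.truncn (c / e)).+1; apply: ltW; apply: truncnS_gt.
(* The exponent [2 n] is nonzero, so it can be written [N2.+1], the shape that [cpos_peak]
   expects. *)
pose n := m.+1; pose N2 := (n + n).-1.
have N2E : N2.+1 = (n + n)%N by rewrite /N2 /n addSn.
pose d : R := c / N2.+1%:R.
have d0 : 0 <= d by rewrite divr_ge0 // ltW.
have de : d <= e.
  rewrite /d ler_pdivrMr ?ltr0n // mulrC -ler_pdivrMr //.
  by apply: (le_trans hm); rewrite ler_nat N2E /n addSn ltnW // ltnS leq_addr.
pose Y := V ^+ n * 'X * V ^+ n.
have YE : Y = c%:P * (V ^+ N2.+1 * (1 - V)).
  by rewrite /Y {1}XV N2E exprD; ring.
pose y := x * ev h (V ^+ n).
have yE : star y * y = ev h Y.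
  by rewrite /y /Y starM star_ev // !evM evX /h !mulrA.
have s1 : csn_pos (rs d - star y * y).
  rewrite yE -(evC h) -evB; apply/csn_pos_ev => //.
  have -> : d%:P - Y = c%:P * ((N2.+1%:R^-1)%:P - V ^+ N2.+1 * (1 - V)).
    by rewrite YE /d polyCM; ring.
  by apply: (cposZ S (ltW c0)); apply: (cpos_peak S).
have s2 := csn_posD (csn_pos_star_mul_add y) (csn_pos_swap d0 s1).
have s3 : cposev h (Y + d%:P).
  apply/csn_pos_ev => //; rewrite evD evC -yE.
  by move: s2; rewrite -addrA [y * star y + _]addrC subrK.
(* As [h = c (1 - V)] and [Y = c (1 - V) V^(2n)], their difference is [c (1 - V) (1 - V^(2n))],
   positive by [cpos_chebyshev]. *)
have -> : 'X + e%:P = (Y + d%:P) + c%:P * ((V - 1) * (V ^+ N2.+1 - 1)) + (e - d)%:P.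
  by rewrite YE [X in X + _ = _]XV polyCB; ring.
apply: (cposD S); last by apply: (cpos_const S); rewrite subr_ge0.
by apply: (cposD S) => //; apply: (cposZ S (ltW c0)); apply: (cpos_chebyshev S).
Qed.

(** For an approximate square root [z] of [k], the element [v^* z^2 v] is [(z v)^* (z v)], positive
    by [csn_pos_star_mul]. *)
Lemma csn_pos_conj k v : csn_pos k -> csn_pos (star v * k * v).
Proof.
move=> kp; apply: csn_pos_approx.
  by rewrite !starM starK kp.1 mulrA.
move=> e e0; pose M := N v ^+ 2 + 1.
have M0 : 0 < M by rewrite /M; have := sqr_ge0 (N v); lra.
have eM : 0 < e / M by rewrite divr_gt0.
have [z [zs hz]] := csn_pos_sqrt_approx kp eM.
exists (star v * (z * z) * v); split.
  have -> : star v * (z * z) * v = star (z * v) * (z * v) by rewrite starM zs !mulrA.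
  exact: csn_pos_star_mul.
rewrite csn_NBC -mulrBl -mulrBr.
apply: (le_trans (NM _ _)); rewrite -(ler_pM2r M0).
move: hz; rewrite ler_pdivlMr // => hz.
have h1 := NM (star v) (z * z - k); rewrite csn_Nstar in h1.
have h2 := N_ge0 v; have h3 := N_ge0 (z * z - k).
have h4 := ler_wpM2r h2 h1.
have h5 := ler_wpM2l (sqr_ge0 (N v)) hz.
have h6 : 0 <= e by exact: ltW.
apply: (le_trans (ler_wpM2r (ltW M0) h4)).
have -> : N v * N (z * z - k) * N v * M = N v ^+ 2 * (N (z * z - k) * M) by ring.
apply: (le_trans h5); rewrite mulrC ler_wpM2l // /M; lra.
Qed.

Lemma small_mul_pow a d (c : R) : csn_pos a -> 0 < c -> N a <= c ->
  (forall e, 0 < e -> exists2 t, 0 <= t & csn_pos (rs e + (t%:C)%C *: a - star d * d)) ->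
  forall e, 0 < e -> exists n, N (d * (1 - (c^-1%:C)%C *: a) ^+ n.+1) <= e.
Proof.
move=> ap c0 ac hyp e e0; set v := 1 - _.
have vp : csn_pos v.
  have -> : v = rs 1 - (c^-1%:C)%C *: a by rewrite rmorph1 scale1r.
  apply: csn_pos_small; first by rewrite starZ conjc_real_complex ap.1.
  by rewrite csn_Zreal ger0_norm ?invr_ge0 ?(ltW c0) // -ler_pdivlMl ?invr_gt0 // invrK mulr1.
have wE : 1 - v = (c^-1%:C)%C *: a by rewrite /v opprB addrC subrK.
have wp : csn_pos (1 - v) by rewrite wE; apply: csn_posZ => //; rewrite invr_ge0 ltW.
have Nv : N v <= 1 by apply: csn_pos_norm_le => //; rewrite rmorph1 scale1r.
have e2 : 0 < e ^+ 2 / 2 by rewrite divr_gt0 // exprn_gt0.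
have [t t0 tp] := hyp _ e2.
(* Since [t] depends on [e], the exponent is chosen after it, so that [t c / n.+1] is at most
   [e^2 / 2]. The square comes from the C*-identity for [d w]. *)
have [n hn] : exists n : nat, t * c / (e ^+ 2 / 2) <= n.+1%:R.
  exists (Num.truncn (t * c / (e ^+ 2 / 2))); apply: ltW; apply: truncnS_gt.
exists n; set w := v ^+ n.+1.
have ws : star w = w by rewrite csn_starX vp.1.
have Nw : N w <= 1.
  rewrite /w; elim: {hn w ws} n => [|n IH]; first by rewrite expr1.
  rewrite exprS; apply: (le_trans (NM _ _)).
  by rewrite mulr_ile1 ?N_ge0.
(* As [a = c (1 - v)], the product [a w] is a multiple of the element bounded by [csn_peak]. *)
have aw : N (a * w) <= c / n.+1%:R.
  have -> : a * w = (c%:C)%C *: (w * (1 - v)).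
    have -> : w * (1 - v) = (1 - v) * w.
      by rewrite mulrBr mulrBl mulr1 mul1r /w -exprSr -exprS.
    by rewrite wE -scalerAl scalerA -rmorphM mulfV ?gt_eqF // rmorph1 scale1r.
  by rewrite csn_Zreal gtr0_norm // ler_wpM2l ?(ltW c0) //; apply: csn_peak.
rewrite -ler_sqr ?nnegrE ?N_ge0 ?(ltW e0) // -NC starM ws.
set k := rs _ + _ in tp.
have h1 : csn_pos (w * (star d * d) * w).
  by rewrite -{1}ws; apply: csn_pos_conj; apply: csn_pos_star_mul.
have h2 : csn_pos (w * k * w - w * (star d * d) * w).
  by rewrite -mulrBl -mulrBr -{1}ws; apply: csn_pos_conj.
have kw : N (w * k * w) <= e ^+ 2.
  have -> : w * k * w = w * ((e ^+ 2 / 2)%:C%C *: w + (t%:C)%C *: (a * w)).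
    by rewrite -mulrA /k mulrDl mulr_algl -scalerAl.
  apply: (le_trans (NM _ _)).
  have h3 := ND ((e ^+ 2 / 2)%:C%C *: w) ((t%:C)%C *: (a * w)).
  rewrite !csn_Zreal (gtr0_norm e2) (ger0_norm t0) in h3.
  have h4 : t * N (a * w) <= e ^+ 2 / 2.
    apply: (le_trans (ler_wpM2l t0 aw)).
    by rewrite mulrA ler_pdivrMr ?ltr0n // [leRHS]mulrC -ler_pdivrMr.
  have h5 : (e ^+ 2 / 2) * N w <= e ^+ 2 / 2 by rewrite ler_piMr // (ltW e2).
  have h6 : N ((e ^+ 2 / 2)%:C%C *: w + (t%:C)%C *: (a * w)) <= e ^+ 2 by lra.
  by rewrite -[leRHS]mul1r; apply: ler_pM; rewrite ?N_ge0.
have h7 : csn_pos (rs (e ^+ 2) - w * k * w).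
  apply: csn_pos_small kw; have := (csn_posD h1 h2).1.
  by rewrite addrC subrK.
rewrite mulrA -[w * star d * d]mulrA; apply: csn_pos_norm_le => //.
  by rewrite exprn_ge0 // ltW.
by have := csn_posD h7 h2; rewrite addrA subrK.
Qed.
End CstarSeminorm.

(** * The Hahn-Banach theorem *)

Section HahnBanach.
Variables (R : realType) (V : lmodType R).
Implicit Types (p q : V -> R) (x y : V).
Local Open Scope classical_set_scope.

Definition sublinear q := (forall x y, q (x + y) <= q x + q y) /\
  (forall c x, 0 < c -> q (c *: x) <= c * q x).

Lemma sublinear0 q : sublinear q -> q 0 = 0.
Proof.
move=> [qD qZ]; have h1 := qZ 2 0 ltac:(lra); have h2 := qZ 2^-1 0 ltac:(lra).
by rewrite !scaler0 in h1 h2; lra.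
Qed.

Lemma sublinearZ q c x : sublinear q -> 0 <= c -> q (c *: x) = c * q x.
Proof.
move=> qs; rewrite le_eqVlt => /predU1P[<-|c0].
  by rewrite scale0r mul0r sublinear0.
apply/le_anti; rewrite qs.2 //= -ler_pdivlMl //.
have := qs.2 c^-1 (c *: x) _; rewrite scalerA mulVf ?gt_eqF // scale1r.
by apply; rewrite invr_gt0.
Qed.

Lemma sublinear_ge q x : sublinear q -> - q (- x) <= q x.
Proof. by move=> qs; have := qs.1 x (- x); rewrite subrr sublinear0 //; lra. Qed.

(** This pushes [q] down until it is linear along [y]: taking [t = 1] at [- y] gives
    [lower q y (- y) <= - q y]. *)
Definition lower q y x := inf [set q (x + t *: y) - t * q y | t in [set t | 0 <= t]].

Lemma lower_has_inf q y x : sublinear q ->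
  has_inf [set q (x + t *: y) - t * q y | t in [set t | 0 <= t]].
Proof.
move=> qs; split; first by exists (q (x + 0 *: y) - 0 * q y), 0 => /=.
exists (- q (- x)) => _ [t /= t0 <-].
have := qs.1 (x + t *: y) (- x); rewrite addrC addrA addNr add0r sublinearZ //.
by lra.
Qed.

Lemma lower_le q y x t : sublinear q -> 0 <= t -> lower q y x <= q (x + t *: y) - t * q y.
Proof. by move=> qs t0; apply: (ge_inf (lower_has_inf y x qs).2); exists t. Qed.

Lemma lower_ge q y x m : sublinear q ->
  (forall t, 0 <= t -> m <= q (x + t *: y) - t * q y) -> m <= lower q y x.
Proof.
move=> qs h; apply: lb_le_inf; first exact: (lower_has_inf y x qs).1.
by move=> _ [t /= t0 <-]; apply: h.
Qed.

Lemma lower_sublinear q y : sublinear q -> sublinear (lower q y).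
Proof.
move=> qs; split=> [x x'|c x c0].
  rewrite -lerBlDr; apply: lower_ge => // t t0.
  rewrite lerBlDl -lerBlDr; apply: lower_ge => // s s0.
  rewrite lerBlDr; apply: (le_trans (lower_le y (x + x') qs (addr_ge0 s0 t0))).
  have := qs.1 (x' + s *: y) (x + t *: y).
  by rewrite addrACA [x' + x]addrC -scalerDl mulrDl; lra.
rewrite -ler_pdivrMl //; apply: lower_ge => // t t0.
rewrite ler_pdivrMl //.
apply: (le_trans (lower_le y (c *: x) qs (mulr_ge0 (ltW c0) t0))).
by rewrite -scalerA -scalerDr sublinearZ ?(ltW c0) // mulrBr mulrA.
Qed.

Lemma lower_le_self q y x : sublinear q -> lower q y x <= q x.
Proof.
by move=> qs; have := lower_le y x qs (lexx 0); rewrite scale0r addr0 mul0r subr0.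
Qed.

Lemma exists_minimal_sublinear p : sublinear p -> exists q,
  [/\ sublinear q, forall x, q x <= p x &
   forall r, sublinear r -> (forall x, r x <= q x) -> forall x, q x <= r x].
Proof.
move=> ps.
pose T := {q : V -> R | sublinear q /\ forall x, q x <= p x}.
(* The order is reversed, so that Zorn's lemma yields a minimal functional. *)
pose le (s t : T) := `[< forall x, sval t x <= sval s x >].
pose p0 : T := exist _ p (conj ps (fun x => lexx (p x))).
have [||A Atot|[q [qs qp]] qmin] := @ZL_preorder T p0 le.
- by move=> t; apply/asboolP.
- move=> r s t /asboolP rs /asboolP st; apply/asboolP => x.
  exact: le_trans (st x) (rs x).
- have [[q0 Aq0]|Ae] := pselect (exists s, A s); last first.
    by exists p0 => s As; exfalso; apply: Ae; exists s.
  pose S x := [set sval s x | s in A].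
  have Sinf x : has_inf (S x).
    split; first by exists (sval q0 x), q0.
    exists (- p (- x)) => _ [[q [qs qp]] Aq <-] /=.
    by have := sublinear_ge x qs; have := qp (- x); lra.
  have Qle (q : T) x : A q -> inf (S x) <= sval q x.
    by move=> Aq; apply: (ge_inf (Sinf x).2); exists q.
  have Qge x m : (forall q : T, A q -> m <= sval q x) -> m <= inf (S x).
    move=> h; apply: lb_le_inf; first exact: (Sinf x).1.
    by move=> _ [q Aq <-]; apply: h.
  (* Subadditivity of the pointwise infimum uses the chain: of two members, the smaller one serves
     at both points. *)
  have Qs : sublinear (fun x => inf (S x)).
    split=> [x y|c x c0].
      rewrite -lerBlDr; apply: (Qge) => q Aq; rewrite lerBlDl -lerBlDr.
      apply: (Qge) => r Ar; rewrite lerBlDr.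
      have [/asboolP h|/asboolP h] := Atot _ _ Aq Ar.
        apply: (le_trans (Qle _ (x + y) Ar)); have := (svalP r).1.1 x y.
        by have := h x; lra.
      apply: (le_trans (Qle _ (x + y) Aq)); have := (svalP q).1.1 x y.
      by have := h y; lra.
    rewrite -ler_pdivrMl //; apply: (Qge) => q Aq; rewrite ler_pdivrMl //.
    by apply: (le_trans (Qle _ _ Aq)); apply: (svalP q).1.2.
  have Qp x : inf (S x) <= p x by apply: (le_trans (Qle _ x Aq0)); apply: (svalP q0).2.
  exists (exist _ (fun x => inf (S x)) (conj Qs Qp)) => s As.
  by apply/asboolP => x /=; apply: Qle.
exists q; split=> // r rs rq x.
have rp y : r y <= p y by apply: le_trans (qp y).
by have /asboolP/(_ x) := qmin (exist _ r (conj rs rp)) (introT (asboolP _) rq).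
Qed.

(** A minimal sublinear [psi] satisfies [psi <= lower psi y], which at [t = 1] is superadditivity,
    so [psi] is linear. Starting below [lower p x0] forces [psi (- x0) <= - p x0], hence equality at
    [x0]. *)
Lemma hahn_banach p x0 : sublinear p -> exists psi : V -> R,
  [/\ forall c x y, psi (c *: x + y) = c * psi x + psi y,
      forall x, psi x <= p x & psi x0 = p x0].
Proof.
move=> ps; have [psi [qs qp qmin]] := exists_minimal_sublinear (lower_sublinear x0 ps).
have psip x : psi x <= p x by apply: le_trans (lower_le_self x0 x ps).
have psiD x y : psi (x + y) = psi x + psi y.
  apply/le_anti; rewrite qs.1 /=.
  have := qmin _ (lower_sublinear y qs) (fun z => lower_le_self y z qs) x.
  move/le_trans => /(_ _ (lower_le y x qs ler01)).
  by rewrite scale1r mul1r; lra.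
have psiN x : psi (- x) = - psi x.
  by have := psiD x (- x); rewrite subrr sublinear0 //; lra.
have psiZ c x : psi (c *: x) = c * psi x.
  have [c0|c0] := leP 0 c; first exact: sublinearZ.
  rewrite -[c]opprK scaleNr psiN sublinearZ ?oppr_ge0 ?(ltW c0) //.
  by rewrite !mulNr.
exists psi; split=> //; first by move=> c x y; rewrite psiD psiZ.
apply/le_anti; rewrite psip /=.
have := le_trans (qp (- x0)) (lower_le x0 (- x0) ps ler01).
by rewrite scale1r mul1r addNr sublinear0 // psiN; lra.
Qed.

End HahnBanach.

(** * The unitization of a C*-algebra *)

Section CstarBasics.
Variables (R : realType) (A : cstar_algebra R).
Implicit Types (x y z : A) (c : R[i]).

Lemma cs_mul_addl x y z : cs_mul (x + y) z = cs_mul x z + cs_mul y z.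
Proof. by have := cs_mulDl 1 x y z; rewrite !scale1r. Qed.
Lemma cs_mul_addr x y z : cs_mul z (x + y) = cs_mul z x + cs_mul z y.
Proof. by have := cs_mulDr 1 x y z; rewrite !scale1r. Qed.
Lemma cs_mul0l z : cs_mul 0 z = 0.
Proof. by apply: (addrI (cs_mul 0 z)); rewrite -cs_mul_addl !addr0. Qed.
Lemma cs_mul0r z : cs_mul z 0 = 0.
Proof. by apply: (addrI (cs_mul z 0)); rewrite -cs_mul_addr !addr0. Qed.
Lemma cs_mulZl c x z : cs_mul (c *: x) z = c *: cs_mul x z.
Proof. by have := cs_mulDl c x 0 z; rewrite cs_mul0l !addr0. Qed.
Lemma cs_mulZr c x z : cs_mul z (c *: x) = c *: cs_mul z x.
Proof. by have := cs_mulDr c x 0 z; rewrite cs_mul0r !addr0. Qed.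

Lemma cs_mulNr x z : cs_mul z (- x) = - cs_mul z x.
Proof. by rewrite -scaleN1r cs_mulZr scaleN1r. Qed.

Lemma cs_star0 : cs_star (0 : A) = 0.
Proof. by apply: (addrI (cs_star (0 : A))); rewrite -cs_starD !addr0. Qed.
Lemma cs_starN x : cs_star (- x) = - cs_star x.
Proof. by apply/eqP; rewrite -addr_eq0 -cs_starD addNr cs_star0. Qed.

(* [cs_starZ] is stated with [Num.conj] of the closed field [R[i]]. *)
Lemma cs_star_scale c x : cs_star (c *: x) = (c^*)%C *: cs_star x.
Proof. exact: cs_starZ. Qed.

Lemma cs_norm0 : cs_norm (0 : A) = 0.
Proof. by rewrite -(scale0r (0 : A)) cs_normZ normc0 mul0r. Qed.
Lemma cs_normN x : cs_norm (- x) = cs_norm x.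
Proof.
rewrite -scaleN1r cs_normZ.
have -> : (-1 : R[i]) = ((-1)%:C)%C by rewrite rmorphN rmorph1.
by rewrite normc_real normrN1 mul1r.
Qed.
Lemma cs_norm_ge0 x : 0 <= cs_norm x.
Proof. by have := cs_normD x (- x); rewrite subrr cs_norm0 cs_normN; lra. Qed.

Lemma cs_norm_star x : cs_norm (cs_star x) = cs_norm x.
Proof.
have le y : cs_norm y <= cs_norm (cs_star y).
  have [->|yn0] := eqVneq (cs_norm y) 0; first exact: cs_norm_ge0.
  have yp : 0 < cs_norm y by rewrite lt_def yn0 cs_norm_ge0.
  by rewrite -(ler_pM2r yp) -expr2 -cs_cstar cs_normM.
by apply/le_anti; rewrite le -{2}[x]cs_starK le.
Qed.
End CstarBasics.

Lemma normc_ge0 (R : realType) (c : R[i]) : 0 <= normc c.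
Proof. by case: c => a b; rewrite /normc sqrtr_ge0. Qed.

(** The pair [(x, l)] stands for the formal sum [x + l 1], even when [A] has a unit. *)
Definition unitization (R : realType) (A : cstar_algebra R) : Type := (A * R[i])%type.

Section Unitization.
Variables (R : realType) (A : cstar_algebra R).
Local Notation U := (unitization A).

HB.instance Definition _ := GRing.Lmodule.copy U (A * R[i])%type.

Definition u_one : U := (0, 1).
Definition u_mul (u w : U) : U :=
  (cs_mul u.1 w.1 + u.2 *: w.1 + w.2 *: u.1, u.2 * w.2).
Definition u_star (u : U) : U := (cs_star u.1, (u.2^*)%C).

Lemma u_addE (u w : U) : u + w = (u.1 + w.1, u.2 + w.2). Proof. by []. Qed.
Lemma u_scaleE c (u : U) : c *: u = (c *: u.1, c * u.2). Proof. by []. Qed.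

Lemma u_mulA : associative u_mul.
Proof.
move=> [x l] [y m] [z n]; rewrite /u_mul /=; congr (_, _); last by rewrite mulrA.
rewrite !(cs_mul_addl, cs_mul_addr, cs_mulZl, cs_mulZr) !cs_mulA !scalerDr !scalerA -!addrA.
rewrite [n * l]mulrC [n * m]mulrC; congr (_ + _).
by rewrite [RHS]addrCA; congr (_ + _); rewrite addrCA; congr (_ + _); exact: addrCA.
Qed.
Lemma u_mul1l : left_id u_one u_mul.
Proof. by move=> [x l]; rewrite /u_mul /= cs_mul0l scale1r scaler0 add0r addr0 mul1r. Qed.
Lemma u_mul1r : right_id u_one u_mul.
Proof. by move=> [x l]; rewrite /u_mul /= cs_mul0r scale1r scaler0 !add0r mulr1. Qed.
Lemma u_mulDl : left_distributive u_mul +%R.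
Proof.
move=> [x l] [y m] [z n]; rewrite /u_mul !u_addE /=; congr (_, _); last by rewrite mulrDl.
by rewrite cs_mul_addl scalerDr scalerDl [RHS]addrACA; congr (_ + _); rewrite addrACA.
Qed.
Lemma u_mulDr : right_distributive u_mul +%R.
Proof.
move=> [x l] [y m] [z n]; rewrite /u_mul !u_addE /=; congr (_, _); last by rewrite mulrDr.
by rewrite cs_mul_addr scalerDr scalerDl [RHS]addrACA; congr (_ + _); rewrite addrACA.
Qed.
Lemma u_one_neq0 : u_one != 0.
Proof. by apply/eqP => -[]; apply/eqP; rewrite oner_eq0. Qed.

HB.instance Definition _ := GRing.Zmodule_isNzRing.Build U
  u_mulA u_mul1l u_mul1r u_mulDl u_mulDr u_one_neq0.

Lemma u_scaleAl c (u w : U) : c *: (u * w) = (c *: u) * w.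
Proof.
case: u w => [x l] [y m]; rewrite /GRing.mul /= /u_mul !u_scaleE /=; congr (_, _).
  by rewrite cs_mulZl !scalerDr !scalerA [m * c]mulrC.
by rewrite mulrA.
Qed.
HB.instance Definition _ := GRing.Lmodule_isLalgebra.Build R[i] U u_scaleAl.
Lemma u_scaleAr c (u w : U) : c *: (u * w) = u * (c *: w).
Proof.
case: u w => [x l] [y m]; rewrite /GRing.mul /= /u_mul !u_scaleE /=; congr (_, _).
  by rewrite cs_mulZr !scalerDr !scalerA [l * c]mulrC.
by rewrite mulrCA.
Qed.
HB.instance Definition _ := GRing.Lalgebra_isAlgebra.Build R[i] U u_scaleAr.

(** * The action on [A] by left multiplication and its operator seminorm *)

Definition u_op (u : U) (y : A) : A := cs_mul u.1 y + u.2 *: y.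

Lemma u_opD u w y : u_op (u + w) y = u_op u y + u_op w y.
Proof. by rewrite /u_op u_addE /= cs_mul_addl scalerDl addrACA. Qed.

Lemma u_opZ c u y : u_op (c *: u) y = c *: u_op u y.
Proof. by rewrite /u_op u_scaleE /= cs_mulZl scalerDr scalerA. Qed.

Lemma u_op_scale c u y : u_op u (c *: y) = c *: u_op u y.
Proof. by rewrite /u_op cs_mulZr scalerDr !scalerA mulrC. Qed.

Lemma u_opM u w y : u_op (u * w) y = u_op u (u_op w y).
Proof.
rewrite /u_op {1}/GRing.mul /= !(cs_mul_addl, cs_mul_addr, cs_mulZl, cs_mulZr) cs_mulA.
rewrite !scalerDr scalerA -!addrA; congr (_ + _).
by rewrite addrCA addrA [_ + u.2 *: _]addrC -addrA.
Qed.

(** For the [A]-valued inner product [y^* z], the adjoint of [u_op u] is [u_op (u_star u)]. *)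
Lemma u_op_adj u y z : cs_mul (cs_star (u_op u y)) z = cs_mul (cs_star y) (u_op (u_star u) z).
Proof.
by rewrite /u_op cs_starD cs_star_scale cs_starM cs_mul_addl cs_mul_addr cs_mulZl cs_mulZr cs_mulA.
Qed.

Lemma u_op_bound u y : cs_norm (u_op u y) <= (cs_norm u.1 + normc u.2) * cs_norm y.
Proof.
rewrite mulrDl -cs_normZ; apply: (le_trans (cs_normD _ _)).
by rewrite lerD2r cs_normM.
Qed.

Local Open Scope classical_set_scope.
Definition u_norm (u : U) : R :=
  sup [set cs_norm (u_op u y) | y in [set y : A | cs_norm y <= 1]].

Lemma u_norm_has_sup u :
  has_sup [set cs_norm (u_op u y) | y in [set y : A | cs_norm y <= 1]].
Proof.
split; first by exists (cs_norm (u_op u 0)), 0 => //=; rewrite cs_norm0.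
exists (cs_norm u.1 + normc u.2) => _ [y /= y1 <-].
apply: (le_trans (u_op_bound u y)); rewrite ler_piMr // addr_ge0 ?cs_norm_ge0 //.
exact: normc_ge0.
Qed.

Lemma u_norm_le u M : (forall y, cs_norm y <= 1 -> cs_norm (u_op u y) <= M) -> u_norm u <= M.
Proof.
move=> h; apply: ge_sup; first exact: (u_norm_has_sup u).1.
by move=> _ [y /= y1 <-]; apply: h.
Qed.

Lemma u_norm_ge0 u : 0 <= u_norm u.
Proof.
apply: le_trans (cs_norm_ge0 (u_op u 0)) _.
by apply: (ub_le_sup (u_norm_has_sup u).2); exists 0 => //=; rewrite cs_norm0.
Qed.

Lemma u_op_norm u y : cs_norm (u_op u y) <= u_norm u * cs_norm y.
Proof.
have [y0|yn0] := eqVneq (cs_norm y) 0.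
  by have := u_op_bound u y; rewrite y0 !mulr0.
have yp : 0 < cs_norm y by rewrite lt_def yn0 cs_norm_ge0.
rewrite mulrC -ler_pdivrMl //.
have iy : normc ((cs_norm y)^-1%:C)%C = (cs_norm y)^-1.
  by rewrite normc_real ger0_norm // invr_ge0 ltW.
rewrite -iy -cs_normZ -u_op_scale.
apply: (ub_le_sup (u_norm_has_sup u).2); exists (((cs_norm y)^-1%:C)%C *: y) => //=.
by rewrite cs_normZ iy mulVf // gt_eqF.
Qed.

Lemma u_norm_submul u w : u_norm (u * w) <= u_norm u * u_norm w.
Proof.
apply: u_norm_le => y y1; rewrite u_opM.
apply: (le_trans (u_op_norm _ _)); rewrite ler_wpM2l ?u_norm_ge0 //.
by apply: (le_trans (u_op_norm _ _)); rewrite ler_piMr ?u_norm_ge0.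
Qed.

Lemma u_norm_scale_le c u : u_norm (c *: u) <= normc c * u_norm u.
Proof.
apply: u_norm_le => y y1; rewrite u_opZ cs_normZ ler_wpM2l ?normc_ge0 //.
by apply: (le_trans (u_op_norm _ _)); rewrite ler_piMr ?u_norm_ge0.
Qed.

(** As for operators on a Hilbert space: the C*-identity of [A] and [u_op_adj] turn the square of
    the norm of [u y] into the norm of [y^* (u^* u y)]. *)
Lemma u_norm_sqr_le u : u_norm u ^+ 2 <= u_norm (u_star u * u).
Proof.
suff h : u_norm u <= Num.sqrt (u_norm (u_star u * u)).
  rewrite -[leRHS]sqr_sqrtr ?u_norm_ge0 // ler_sqr ?nnegrE ?u_norm_ge0 //.
  exact: sqrtr_ge0.
apply: u_norm_le => y y1; rewrite -(@ler_sqr R) ?nnegrE ?cs_norm_ge0 ?sqrtr_ge0 //.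
rewrite sqr_sqrtr ?u_norm_ge0 // -cs_cstar u_op_adj -u_opM.
apply: (le_trans (cs_normM _ _)); rewrite cs_norm_star.
rewrite -[leRHS]mul1r; apply: ler_pM; rewrite ?cs_norm_ge0 //.
by apply: (le_trans (u_op_norm _ _)); rewrite ler_piMr ?u_norm_ge0.
Qed.

Lemma u_starK u : u_star (u_star u) = u.
Proof. by case: u => x [a b]; rewrite /u_star /= cs_starK opprK. Qed.

Lemma u_norm_cstar u : u_norm (u_star u * u) = u_norm u ^+ 2.
Proof.
have le w : u_norm w <= u_norm (u_star w).
  have [->|wn0] := eqVneq (u_norm w) 0; first exact: u_norm_ge0.
  have wp : 0 < u_norm w by rewrite lt_def wn0 u_norm_ge0.
  rewrite -(ler_pM2r wp) -expr2; apply: (le_trans (u_norm_sqr_le w)).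
  exact: u_norm_submul.
have eq : u_norm (u_star u) = u_norm u.
  by apply/le_anti; rewrite le -{2}[u]u_starK le.
apply/le_anti; rewrite u_norm_sqr_le andbT expr2 -{1}eq.
exact: u_norm_submul.
Qed.

Lemma u_cstar_seminorm : is_cstar_seminorm u_star u_norm.
Proof.
split.
- exact: u_starK.
- move=> u w; rewrite /u_star !u_addE /= cs_starD; congr (_, _).
  by case: u w => [_ [a b]] [_ [c d]] /=; congr Complex; rewrite opprD.
- move=> c u; rewrite /u_star !u_scaleE /= cs_star_scale; congr (_, _).
  by rewrite rmorphM.
- move=> u w; rewrite /u_star /GRing.mul /= /u_mul /=; congr (_, _).
    by rewrite !cs_starD !cs_star_scale cs_starM -!addrA [X in _ + X]addrC.
  by rewrite -[LHS]/(((u.2 * w.2)^*)%C) rmorphM mulrC.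
- exact: u_norm_ge0.
- move=> u w; apply: u_norm_le => y y1; rewrite u_opD.
  apply: (le_trans (cs_normD _ _)); apply: lerD.
    by apply: (le_trans (u_op_norm _ _)); rewrite ler_piMr ?u_norm_ge0.
  by apply: (le_trans (u_op_norm _ _)); rewrite ler_piMr ?u_norm_ge0.
- exact: u_norm_submul.
- move=> c u; apply/le_anti; rewrite u_norm_scale_le /=.
  have [->|cn0] := eqVneq c 0; first by rewrite normc0 mul0r u_norm_ge0.
  have cp : 0 < normc c.
    by rewrite lt_def normc_ge0 andbT; apply: contra_neq cn0; exact: eq0_normc.
  rewrite mulrC -ler_pdivlMr // mulrC -normcV.
  have := u_norm_scale_le c^-1 (c *: u).
  by rewrite scalerA mulVf // scale1r.
- apply: u_norm_le => y y1.
  by rewrite /u_op /= cs_mul0l add0r scale1r.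
- exact: u_norm_cstar.
Qed.

Definition u_in (x : A) : U := (x, 0).

(** The lower bound comes from testing against [x^*], since [x x^*] has norm the square of that of
    [x]. *)
Lemma u_norm_in x : u_norm (u_in x) = cs_norm x.
Proof.
apply/le_anti/andP; split.
  apply: u_norm_le => y y1; rewrite /u_op /= scale0r addr0.
  by apply: (le_trans (cs_normM _ _)); rewrite ler_piMr ?cs_norm_ge0.
have := u_op_norm (u_in x) (cs_star x); rewrite /u_op /= scale0r addr0.
rewrite cs_norm_star -{1}[x]cs_starK cs_cstar cs_norm_star expr2.
have [->|xn0] := eqVneq (cs_norm x) 0; first by rewrite u_norm_ge0.
by rewrite ler_pM2r // lt_def xn0 cs_norm_ge0.
Qed.

Lemma u_inD x y : u_in (x + y) = u_in x + u_in y.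
Proof. by rewrite /u_in u_addE /= addr0. Qed.
Lemma u_inZ c x : u_in (c *: x) = c *: u_in x.
Proof. by rewrite /u_in u_scaleE /= mulr0. Qed.
Lemma u_inN x : u_in (- x) = - u_in x.
Proof. by rewrite -scaleN1r u_inZ scaleN1r. Qed.
Lemma u_in_mul x y : u_in (cs_mul x y) = u_in x * u_in y.
Proof. by rewrite /u_in /GRing.mul /= /u_mul /= !scale0r !addr0 mulr0. Qed.
Lemma u_in_star x : u_in (cs_star x) = u_star (u_in x).
Proof. by rewrite /u_star /u_in /=; congr (_, _); rewrite oppr0. Qed.

End Unitization.

(** * Domination by multiples of [a] *)

(** A separate type carrying the restriction of scalars to [R], to which the real Hahn-Banach
    theorem applies. *)
Definition realified (R : realType) (V : lmodType R[i]) : Type := V.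

Section Realified.
Variables (R : realType) (V : lmodType R[i]).

HB.instance Definition _ := GRing.Zmodule.on (realified V).

Definition real_scale (c : R) (x : realified V) : realified V := ((c%:C)%C *: (x : V)).

Lemma real_scaleA c d x : real_scale c (real_scale d x) = real_scale (c * d) x.
Proof. by rewrite /real_scale scalerA rmorphM. Qed.
Lemma real_scale1 : left_id 1 real_scale.
Proof. by move=> x; rewrite /real_scale rmorph1 scale1r. Qed.
Lemma real_scaleDr : right_distributive real_scale +%R.
Proof. by move=> c x y; rewrite /real_scale scalerDr. Qed.
Lemma real_scaleDl x : {morph real_scale^~ x : c d / c + d}.
Proof. by move=> c d; rewrite /real_scale rmorphD scalerDl. Qed.

HB.instance Definition _ := GRing.Zmodule_isLmodule.Build R (realified V)
  real_scaleA real_scale1 real_scaleDr real_scaleDl.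

End Realified.

Section RealPart.
Variables (R : realType) (A : cstar_algebra R).
Implicit Types x y : A.

Definition cs_re x : A := ((2^-1)%:C)%C *: (x + cs_star x).

Lemma cs_reD x y : cs_re (x + y) = cs_re x + cs_re y.
Proof. by rewrite /cs_re cs_starD addrACA scalerDr. Qed.
Lemma cs_reZ (c : R) x : cs_re ((c%:C)%C *: x) = (c%:C)%C *: cs_re x.
Proof. by rewrite /cs_re cs_star_scale conjc_real_complex -scalerDr !scalerA mulrC. Qed.
Lemma cs_star_re x : cs_star (cs_re x) = cs_re x.
Proof. by rewrite /cs_re cs_star_scale conjc_real_complex cs_starD cs_starK addrC. Qed.
Lemma cs_re_id x : cs_star x = x -> cs_re x = x.
Proof.
move=> xs; rewrite /cs_re xs -mulr2n -scaler_nat scalerA.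
by rewrite -(rmorph_nat (real_complex R)) -rmorphM mulVf ?pnatr_eq0 // rmorph1 scale1r.
Qed.
Lemma cs_norm_re x : cs_norm (cs_re x) <= cs_norm x.
Proof.
rewrite /cs_re cs_normZ normc_real ger0_norm ?invr_ge0 //.
by have := cs_normD x (cs_star x); rewrite cs_norm_star; lra.
Qed.
Lemma cs_re_i x : cs_star x = x -> cs_re (- 'i%C *: x) = 0.
Proof.
move=> xs; rewrite /cs_re cs_star_scale xs.
have -> : ((- 'i : R[i])^*)%C = 'i%C by apply/eqP; rewrite eq_complex /= oppr0 opprK !eqxx.
by rewrite scaleNr addNr scaler0.
Qed.
End RealPart.

Section Domination.
Variables (R : realType) (A : cstar_algebra R).
Local Notation U := (unitization A).
Local Notation P := (csn_pos (@u_star R A) (@u_norm R A)).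
Local Notation rs c := ((c%:C)%C%:A : U).
Let H := u_cstar_seminorm A.

Lemma u_in_star_mul_pos (x : A) : P (u_in (cs_mul (cs_star x) x)).
Proof. by rewrite u_in_mul u_in_star; apply: (csn_pos_star_mul H). Qed.

Variable a : A.
Hypothesis aP : P (u_in a).

Local Open Scope classical_set_scope.

Definition dom_set (x : A) : set R := [set l | 0 <= l /\
  exists2 t : R, 0 <= t & P (rs l + (t%:C)%C *: u_in a - u_in (cs_re x))].

Definition dom_gauge (x : realified A) : R := inf (dom_set x).

(** Hence the gauge is finite, and linear functionals below it are continuous. *)
Lemma dom_norm x : dom_set x (cs_norm x).
Proof.
split; first exact: cs_norm_ge0.
exists 0 => //; rewrite scale0r addr0; apply: (csn_pos_small H).
  by rewrite -u_in_star cs_star_re.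
by rewrite u_norm_in cs_norm_re.
Qed.

Lemma dom_has_inf x : has_inf (dom_set x).
Proof. by split; [exists (cs_norm x); exact: dom_norm | exists 0 => l []]. Qed.

Lemma dom_gauge_le x l : dom_set x l -> dom_gauge x <= l.
Proof. exact: (ge_inf (dom_has_inf x).2). Qed.

Lemma dom_gauge_ge x m : (forall l, dom_set x l -> m <= l) -> m <= dom_gauge x.
Proof. by move=> h; apply: lb_le_inf => //; exact: (dom_has_inf x).1. Qed.

Lemma dom_gauge_sublinear : sublinear dom_gauge.
Proof.
split=> [x y|c x c0].
  rewrite -lerBlDr; apply: dom_gauge_ge => l [l0 [t t0 lt]].
  rewrite lerBlDl -lerBlDr; apply: dom_gauge_ge => m [m0 [s s0 ms]].
  rewrite lerBlDr; apply: dom_gauge_le; split; first by rewrite addr_ge0.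
  exists (s + t); first by rewrite addr_ge0.
  rewrite cs_reD u_inD !rmorphD !scalerDl [u_in (cs_re x) + _]addrC opprD.
  rewrite [rs m + rs l + _]addrACA [_ + (- _ - _)]addrACA; exact: (csn_posD H).
rewrite -ler_pdivrMl //; apply: dom_gauge_ge => l [l0 [t t0 lt]].
rewrite ler_pdivrMl //; apply: dom_gauge_le; split; first by rewrite mulr_ge0 // ltW.
exists (c * t); first by rewrite mulr_ge0 // ltW.
rewrite cs_reZ u_inZ !rmorphM -!scalerA -scalerDr -scalerBr.
by apply: (csn_posZ H) => //; apply: ltW.
Qed.

Lemma domination : (forall phi : A -> R[i], cs_positive_functional phi ->
    (exists x : A, phi x != 0) -> 0 < phi a) ->
  forall (b : A) (e : R), cs_star b = b -> 0 < e ->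
  exists2 t : R, 0 <= t & P (rs e + (t%:C)%C *: u_in a - u_in b).
Proof.
move=> hyp b e bs e0; apply: contrapT => hN.
(* If the gauge at [b] were below [e], some admissible [l < e] could be raised to [e], against
   [hN]. *)
have pb : 0 < dom_gauge b.
  apply: (lt_le_trans e0); rewrite leNgt; apply/negP.
  move=> /(inf_lt (dom_has_inf b).1)[l [l0 [t t0 lt]] le].
  apply: hN; exists t => //; rewrite (cs_re_id bs) in lt.
  have -> : rs e + (t%:C)%C *: u_in a - u_in b =
    rs (e - l) - 0 + (rs l + (t%:C)%C *: u_in a - u_in b).
    by rewrite subr0 !addrA -scalerDl -rmorphD subrK.
  apply: (csn_posD H) => //; apply: (csn_pos_small H); first exact: (csn_star0 H).
  by rewrite (csn_N0 H) subr_ge0 ltW.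
have [psi [psiL psip psib]] := hahn_banach (b : realified A) dom_gauge_sublinear.
pose g (x : A) : R := psi (cs_re x).
have psi0 : psi 0 = 0 by have := psiL 1 0 0; rewrite scaler0 addr0 mul1r; lra.
have gD x y : g (x + y) = g x + g y.
  by rewrite /g cs_reD; have := psiL 1 (cs_re x) (cs_re y); rewrite scale1r mul1r.
have gZ (c : R) x : g ((c%:C)%C *: x) = c * g x.
  by rewrite /g cs_reZ; have := psiL c (cs_re x) 0; rewrite !addr0 psi0 addr0.
have gN x : g (- x) = - g x.
  by rewrite -scaleN1r -(rmorph1 (real_complex R)) -rmorphN gZ mulN1r.
have g_le x : g x <= cs_norm x.
  apply: (le_trans (psip _)); apply: le_trans (cs_norm_re x).
  by apply: dom_gauge_le; exact: dom_norm.
have g_abs x : `|g x| <= cs_norm x.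
  by rewrite ler_norml g_le andbT lerNl -gN -cs_normN g_le.
(* The complex functional with real part [g]: its imaginary part at [x] is its real part at
   [- i x]. *)
pose phi (x : A) : R[i] := (g x +i* g (- 'i%C *: x))%C.
have phi_sa x : cs_star x = x -> phi x = (psi x)%:C%C.
  by move=> xs; rewrite /phi /g cs_re_i // psi0 cs_re_id.
have phiL : cs_linear_functional phi.
  move=> [c d] x y; apply/eqP; rewrite eq_complex /=.
  have E : (c +i* d)%C *: x = (c%:C)%C *: x + (d%:C)%C *: ('i%C *: x).
    rewrite scalerA -scalerDl; congr (_ *: _).
    by apply/eqP; rewrite eq_complex /=; apply/andP; split; apply/eqP; ring.
  have E2 : - 'i%C *: ((d%:C)%C *: ('i%C *: x)) = (d%:C)%C *: x.
    rewrite !scalerA; congr (_ *: _).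
    by apply/eqP; rewrite eq_complex /=; apply/andP; split; apply/eqP; ring.
  have E3 : - 'i%C *: ((c%:C)%C *: x) = (c%:C)%C *: (- 'i%C *: x).
    by rewrite !scalerA mulrC.
  have E4 : g ('i%C *: x) = - g (- 'i%C *: x) by rewrite scaleNr gN opprK.
  rewrite scalerDr E scalerDr E2 E3 !gD !gZ E4.
  by apply/andP; split; apply/eqP; ring.
have phiP : cs_positive_functional phi.
  split; [split=> // | move=> x].
    exists 2 => x; apply: (@le_trans _ _ (`|g x| + `|g (- 'i%C *: x)|)).
      rewrite /normc /phi -(@ler_sqr R) ?nnegrE ?sqrtr_ge0 ?addr_ge0 //.
      rewrite sqr_sqrtr ?addr_ge0 ?sqr_ge0 // -!(real_normK (num_real (g _))).
      have := mulr_ge0 (normr_ge0 (g x)) (normr_ge0 (g (- 'i%C *: x))).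
      by nra.
    have := g_abs (- 'i%C *: x); have := g_abs x; rewrite cs_normZ.
    have -> : normc (- 'i%C : R[i]) = 1.
      by rewrite /normc /= oppr0 expr0n /= sqrrN add0r expr1n sqrtr1.
    by rewrite mul1r; lra.
  have xs : cs_star (cs_mul (cs_star x) x) = cs_mul (cs_star x) x by rewrite cs_starM cs_starK.
  rewrite phi_sa // lecE /= eqxx /=.
  (* At [- x^* x] the gauge is at most 0, witnessed by [l = t = 0]; so [psi] is nonnegative at
     [x^* x]. *)
  have := psip (- (cs_mul (cs_star x) x) : A).
  have -> : psi (- cs_mul (cs_star x) x : A) = - psi (cs_mul (cs_star x) x).
    by have := gN (cs_mul (cs_star x) x); rewrite /g !cs_re_id // cs_starN xs.
  rewrite lerNl => /(le_trans _); apply; rewrite lerNr oppr0.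
  apply: dom_gauge_le; split=> //; exists 0 => //.
  rewrite !scale0r addr0 add0r cs_re_id ?cs_starN ?xs // u_inN opprK.
  exact: u_in_star_mul_pos.
have a_sa : cs_star a = a.
  have := aP.1; rewrite -u_in_star => /(congr1 fst); exact.
have : 0 < phi a.
  apply: hyp => //; exists b; rewrite phi_sa // eq_complex /= psib.
  by rewrite gt_eqF.
rewrite phi_sa // ltcE /= eqxx /=; apply/negP; rewrite -leNgt.
(* At [a] the gauge is at most 0, witnessed by [l = 0] and [t = 1]. *)
apply: (le_trans (psip _)); apply: dom_gauge_le; split=> //; exists 1 => //.
rewrite scale0r add0r rmorph1 scale1r cs_re_id // subrr; exact: (csn_pos0 H).
Qed.

End Domination.

(** * The seminorm on the dual *)

Section Density.
Variables (R : realType) (A : cstar_algebra R) (r : A).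
Hypothesis rs : cs_star r = r.
Local Notation U := (unitization A).
Let a := cs_mul r r.
Let H := u_cstar_seminorm A.

Hypothesis hyp : forall phi : A -> R[i], cs_positive_functional phi ->
    (exists x : A, phi x != 0) -> 0 < phi a.

(** In the expanded power every term except 1 contains [a = r r], so [r] can be factored out on the
    left. *)
Lemma u_one_sub_pow_in (c : R[i]) n : exists s : A,
  (1 - c *: u_in a : U) ^+ n = 1 - u_in (cs_mul r s).
Proof.
elim: n => [|n [s IH]].
  exists 0; rewrite expr0 cs_mul0r.
  by rewrite -(scale0r (0 : A)) u_inZ scale0r subr0.
exists (s + c *: (r - cs_mul r (cs_mul r s))).
rewrite exprS IH mulrBl mul1r -addrA -opprD; congr (1 - _).
rewrite cs_mul_addr u_inD; congr (_ + _).
rewrite cs_mulZr u_inZ -scalerAl; congr (_ *: _).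
rewrite mulrBr mulr1 -u_in_mul -u_inN -u_inD; congr u_in.
by rewrite cs_mul_addr cs_mulNr /a !cs_mulA.
Qed.

(** By [small_mul_pow] some [x v^n] is small. As [v^n = 1 - r s] is selfadjoint, it equals
    [1 - s^* r], so [x] is close to [x s^* r]. *)
Lemma approx_right_factor (x : A) (e : R) : 0 < e ->
  exists s : A, cs_norm (x - cs_mul (cs_mul x s) r) <= e.
Proof.
move=> e0.
have ap : csn_pos (@u_star R A) (@u_norm R A) (u_in a).
  by rewrite /a -{1}rs; apply: u_in_star_mul_pos.
pose c := cs_norm a + 1.
have c0 : 0 < c by rewrite /c; have := cs_norm_ge0 a; lra.
have ac : u_norm (u_in a) <= c by rewrite u_norm_in /c lerDl.
have [|n hn] := small_mul_pow H (d := u_in x) ap c0 ac _ e0.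
  move=> d d0; have xs : cs_star (cs_mul (cs_star x) x) = cs_mul (cs_star x) x.
    by rewrite cs_starM cs_starK.
  have [t t0 ht] := domination ap hyp xs d0.
  by exists t => //; rewrite -u_in_star -u_in_mul.
have [s sE] := u_one_sub_pow_in (c^-1%:C)%C n.+1.
have vs : u_star (1 - u_in (cs_mul r s)) = 1 - u_in (cs_mul r s).
  rewrite -sE (csn_starX H) (csn_starB H) (csn_star1 H) (csn_starZ H).
  by rewrite conjc_real_complex ap.1.
exists (cs_star s); rewrite -u_norm_in.
suff -> : u_in (x - cs_mul (cs_mul x (cs_star s)) r) = u_in x * (1 - u_in (cs_mul r s)).
  by rewrite -sE.
rewrite -vs (csn_starB H) (csn_star1 H) -u_in_star cs_starM rs.
by rewrite mulrBr mulr1 -u_in_mul cs_mulA u_inD u_inN.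
Qed.

Lemma sandwich_inj (f : A -> R[i]) : cs_dual f ->
  (forall x, f (cs_mul (cs_mul r x) r) = 0) -> forall x, f x = 0.
Proof.
move=> [fL [M fM]] f0 x; apply: eq0_normc; apply/le_anti; rewrite normc_ge0 andbT.
have fD y z : f (y + z) = f y + f z by have := fL 1 y z; rewrite scale1r mul1r.
apply: (@ler_addeps _ _ _ (`|M| * 2)); first by rewrite mulr_ge0.
move=> e e0 _; rewrite add0r -mulrA.
(* Applied to [x^*] and starred, the right factor [r] becomes a left factor, contained in [s]. *)
have [s' hs'] := approx_right_factor (cs_star x) e0.
pose s := cs_mul r (cs_star s').
have h1 : cs_norm (x - cs_mul s x) <= e.
  rewrite -cs_norm_star; move: hs'; congr (_ <= _); congr cs_norm.
  by rewrite cs_starD cs_starN /s !cs_starM cs_starK rs !cs_mulA.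
(* The second error gets multiplied by [s] on the left, so its tolerance is divided in advance. *)
have e1 : 0 < e / (cs_norm s + 1).
  by rewrite divr_gt0 //; have := cs_norm_ge0 s; lra.
have [t ht] := approx_right_factor x e1.
have h2 : cs_norm (cs_mul s (x - cs_mul (cs_mul x t) r)) <= e.
  apply: (le_trans (cs_normM _ _)).
  have s0 := cs_norm_ge0 s.
  apply: (le_trans (ler_wpM2l s0 ht)).
  rewrite mulrA ler_pdivrMr; last by lra.
  by rewrite mulrC ler_wpM2l ?(ltW e0) //; lra.
(* The two errors add up to [x - s x t r], and [f] vanishes at [s x t r], which has the form
   [r z r]. *)
have -> : f x = f ((x - cs_mul s x) + cs_mul s (x - cs_mul (cs_mul x t) r)).
  rewrite -[f (_ + _)]addr0 -(f0 (cs_mul (cs_mul (cs_star s') x) t)) -fD.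
  by congr f; rewrite cs_mul_addr addrA subrK cs_mulNr /s !cs_mulA subrK.
apply: (le_trans (fM _)).
have h3 := le_trans (cs_normD (x - cs_mul s x) (cs_mul s (x - cs_mul (cs_mul x t) r))) (lerD h1 h2).
apply: (@le_trans _ _ (`|M| * cs_norm (x - cs_mul s x + cs_mul s (x - cs_mul (cs_mul x t) r)))).
  by rewrite ler_wpM2r ?cs_norm_ge0 // ler_norm.
by rewrite ler_wpM2l //; lra.
Qed.
End Density.

(** * The dual norm, and null vectors of positive functionals *)

Section DualNorm.
Variables (R : realType) (A : cstar_algebra R).
Implicit Types f g : A -> R[i].
Local Open Scope classical_set_scope.

Lemma normcD (c d : R[i]) : normc (c + d) <= normc c + normc d.
Proof. by have := ler_normD c d; rewrite lecE => /andP[]. Qed.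

Lemma dual0 f : cs_linear_functional f -> f 0 = 0.
Proof. by move=> fL; have := fL (-1) 0 0; rewrite scaler0 addr0 mulN1r addNr. Qed.

Lemma dualZ f c x : cs_linear_functional f -> f (c *: x) = c * f x.
Proof. by move=> fL; have := fL c x 0; rewrite !addr0 dual0 // addr0. Qed.

Lemma dual_has_sup f : cs_dual f ->
  has_sup [set normc (f x) | x in [set x : A | cs_norm x <= 1]].
Proof.
move=> [fL [M fM]]; split; first by exists (normc (f 0)), 0 => //=; rewrite cs_norm0.
exists `|M| => _ [x /= x1 <-]; apply: (le_trans (fM x)).
apply: (@le_trans _ _ (`|M| * cs_norm x)); last by rewrite ler_piMr.
by rewrite ler_wpM2r ?cs_norm_ge0 // ler_norm.
Qed.

Lemma dual_norm_ge f x : cs_dual f -> cs_norm x <= 1 -> normc (f x) <= cs_dual_norm f.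
Proof. by move=> fd x1; apply: (ub_le_sup (dual_has_sup fd).2); exists x. Qed.

Lemma dual_norm_le f m : cs_dual f ->
  (forall x, cs_norm x <= 1 -> normc (f x) <= m) -> cs_dual_norm f <= m.
Proof.
move=> fd h; apply: ge_sup; first exact: (dual_has_sup fd).1.
by move=> _ [x /= x1 <-]; apply: h.
Qed.

Lemma dual_norm_ge0 f : cs_dual f -> 0 <= cs_dual_norm f.
Proof.
move=> fd; apply: le_trans (normc_ge0 (f 0)) _; apply: dual_norm_ge => //.
by rewrite cs_norm0.
Qed.

Lemma dual_norm_eq0 f : cs_dual f -> cs_dual_norm f = 0 -> forall x, f x = 0.
Proof.
move=> fd f0 x; pose m := cs_norm x + 1.
have m0 : 0 < m by rewrite /m; have := cs_norm_ge0 x; lra.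
have : normc (f ((m^-1%:C)%C *: x)) <= 0.
  rewrite -f0; apply: dual_norm_ge => //.
  rewrite cs_normZ normc_real ger0_norm ?invr_ge0 ?(ltW m0) //.
  by rewrite ler_pdivrMl // mulr1 /m lerDl.
rewrite (dualZ _ _ fd.1) normcM => h; apply: eq0_normc.
have p0 : 0 < normc (m^-1%:C)%C by rewrite normc_real normr_gt0 invr_eq0 gt_eqF.
by apply/le_anti; rewrite normc_ge0 andbT -(ler_pM2l p0) mulr0.
Qed.

Lemma dual_scale f c : cs_dual f -> cs_dual (fun x => c * f x).
Proof.
move=> [fL [M fM]]; split=> [d x y|]; first by rewrite fL; ring.
exists (normc c * M) => x; rewrite normcM -mulrA ler_wpM2l ?normc_ge0 //.
Qed.

Lemma dual_add f g : cs_dual f -> cs_dual g -> cs_dual (fun x => f x + g x).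
Proof.
move=> [fL [M fM]] [gL [K gK]]; split=> [d x y|]; first by rewrite fL gL; ring.
by exists (M + K) => x; rewrite mulrDl (le_trans (normcD _ _)) // lerD.
Qed.

Lemma dual_normD f g : cs_dual f -> cs_dual g ->
  cs_dual_norm (fun x => f x + g x) <= cs_dual_norm f + cs_dual_norm g.
Proof.
move=> fd gd; apply: dual_norm_le; first exact: dual_add.
by move=> x x1; rewrite (le_trans (normcD _ _)) // lerD // dual_norm_ge.
Qed.

Lemma dual_normZ f c : cs_dual f ->
  cs_dual_norm (fun x => c * f x) = normc c * cs_dual_norm f.
Proof.
have le d g : cs_dual g -> cs_dual_norm (fun x => d * g x) <= normc d * cs_dual_norm g.
  move=> gd; apply: dual_norm_le; first exact: dual_scale.
  by move=> x x1; rewrite normcM ler_wpM2l ?normc_ge0 // dual_norm_ge.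
move=> fd; apply/le_anti; rewrite le //=.
have [->|cn0] := eqVneq c 0.
  by rewrite normc0 mul0r; apply: dual_norm_ge0; exact: dual_scale.
have cp : 0 < normc c.
  by rewrite lt_def normc_ge0 andbT; apply: contra_neq cn0; exact: eq0_normc.
rewrite -ler_pdivlMl // -normcV.
apply: le_trans (le c^-1 _ (dual_scale c fd)).
suff -> : (fun x => c^-1 * (c * f x)) = f by [].
by apply: funext => x; rewrite mulrA mulVf // mul1r.
Qed.

Lemma dual_sandwich r f : cs_dual f -> cs_dual (cs_sandwich r f).
Proof.
move=> [fL [M fM]]; split=> [c x y|]; rewrite /cs_sandwich.
  by rewrite cs_mulDr cs_mulDl fL.
exists (`|M| * (cs_norm r * cs_norm r)) => x; apply: (le_trans (fM _)).
apply: (@le_trans _ _ (`|M| * cs_norm (cs_mul (cs_mul r x) r))).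
  by rewrite ler_wpM2r ?cs_norm_ge0 // ler_norm.
rewrite -!mulrA ler_wpM2l // (le_trans (cs_normM _ _)) //.
rewrite [cs_norm r * cs_norm x]mulrC mulrA ler_wpM2r ?cs_norm_ge0 //.
exact: cs_normM.
Qed.

(** The degenerate case of Cauchy-Schwarz: as [phi (r^* r) = 0], positivity at [y + c r] has no
    quadratic term in [c], and a real affine function bounded below is constant. *)
Lemma positive_functional_null (phi : A -> R[i]) r y : cs_positive_functional phi ->
  phi (cs_mul (cs_star r) r) = 0 -> phi (cs_mul (cs_star y) r) = 0.
Proof.
move=> [[phiL _] phiP] r0.
have phiD u v : phi (u + v) = phi u + phi v by have := phiL 1 u v; rewrite scale1r mul1r.
pose al := phi (cs_mul (cs_star y) r); pose be := phi (cs_mul (cs_star r) y).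
pose K := phi (cs_mul (cs_star y) y).
have pos c : 0 <= K + (c * al + (c^*)%C * be).
  have := phiP (y + c *: r).
  rewrite cs_starD cs_star_scale cs_mul_addl !cs_mul_addr !cs_mulZl !cs_mulZr.
  by rewrite !phiD !(dualZ _ _ phiL) r0 !mulr0 addr0 addrA.
have zero c : c * al + (c^*)%C * be = 0.
  have w t : ((t%:C)%C * c) * al + (((t%:C)%C * c)^*)%C * be = (t%:C)%C * (c * al + (c^*)%C * be).
    have -> : (((t%:C)%C * c)^*)%C = (t%:C)%C * (c^*)%C.
      case: c => c1 c2; apply/eqP; rewrite eq_complex /=.
      by apply/andP; split; apply/eqP; ring.
    by ring.
  set z := _ + _ in w *; have posz t : 0 <= K + (t%:C)%C * z by rewrite -w; exact: pos.
  move: posz; move: (z) (K) => [z1 z2] [k1 k2] posz.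
  (* Comparison with 0 in [R[i]] forces a zero imaginary part; [t = 0] and [t = 1] together give
     [z2 = 0]. *)
  have := posz 0; have := posz 1; rewrite !lecE /= => /andP[/eqP i1 _] /andP[/eqP i0 _].
  have z20 : z2 = 0 by lra.
  have z10 : z1 = 0.
    (* The value of [t] below makes the real part equal to [-1]. *)
    apply/eqP; apply: contrapT => /negP z1n.
    have := posz (- (k1 + 1) / z1); rewrite lecE /= => /andP[_].
    by rewrite mul0r subr0 mulfVK //; lra.
  by rewrite z10 z20.
(* These say [al + be = 0] and [al - be = 0]. *)
have h1 := zero 1; have h2 := zero 'i%C.
rewrite -/al.
have c1 : ((1 : R[i])^*)%C = 1 by rewrite rmorph1.
rewrite c1 !mul1r in h1; rewrite conjc_i mulNr -mulrBr in h2.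
have i0 : ('i%C : R[i]) != 0 by rewrite eq_complex /= oner_eq0 andbF.
move: h2 => /eqP; rewrite mulf_eq0 (negbTE i0) subr_eq0 /= => /eqP h2.
move: h1; rewrite -h2 -mulr2n => /eqP; rewrite mulrn_eq0 /= => /eqP //.
Qed.

End DualNorm.

Unset Implicit Arguments.

(* r plays the role of a^{1/2}: the (unique) positive square root of a. *)
Theorem theorem15 (R : realType) (A : cstar_algebra R) (a r : A) :
  cs_positive a -> cs_positive r -> cs_mul r r = a ->
  (is_norm_on_dual (fun f => cs_dual_norm (cs_sandwich r f)) <->
   (forall phi : A -> R[i], cs_positive_functional phi ->
      (exists x : A, phi x != 0) -> 0 < phi a)).
Proof.
move=> _ [b rE] <-.
have rs : cs_star r = r by rewrite rE cs_starM cs_starK.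
split=> [[_ N0 _ _] phi phiP [x x0]|hyp].
  have phir : 0 <= phi (cs_mul r r) by rewrite -{1}rs; exact: phiP.2.
  rewrite lt_def phir andbT; apply: contra_neq x0 => phi0.
  apply: N0; first exact: phiP.1.
  (* Since [r y r] is [(y^* r)^* r], the vanishing of [phi] at [r^* r = a] suffices. *)
  have phi0' y : cs_sandwich r phi y = 0.
    rewrite /cs_sandwich.
    have -> : cs_mul r y = cs_star (cs_mul (cs_star y) r) by rewrite cs_starM rs cs_starK.
    by apply: positive_functional_null => //; rewrite rs.
  have sd := dual_sandwich r phiP.1.
  apply/le_anti; rewrite dual_norm_ge0 // andbT.
  by apply: dual_norm_le => // y _; rewrite phi0' normc0.
split=> [f fd|f fd f0|f g fd gd|c f fd].
- by apply: dual_norm_ge0; exact: dual_sandwich.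
- by apply: (sandwich_inj rs hyp fd); exact: (dual_norm_eq0 (dual_sandwich r fd) f0).
- by apply: (dual_normD (dual_sandwich r fd) (dual_sandwich r gd)).
- by apply: (dual_normZ c (dual_sandwich r fd)).
Qed.
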